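(* For positive integers $n$ let $$I(n):=\int_0^1 \left[x^n+(1-x)^n\right]^{1/n}\,dx .$$ Then, as $n\to\infty$, $I(n)$ has an asymptotic expansion in powers of $1/n$, $$I(n)\sim \sum_{i=0}^{\infty} \frac{I_i}{n^i},$$ i.e. there are real constants $I_0,I_1,I_2,\dots$ such that for every integer $K\ge 0$, $I(n)=\sum_{i=0}^{K} I_i n^{-i}+O(n^{-K-1})$ as $n\to\infty$; and its first coefficients are $$I_0=\frac34,\quad I_1=0,\quad I_2=\frac{\pi^2}{48},\quad I_3=\frac{\zeta(3)}{8},\quad I_4=-\frac{\pi^4}{960},\quad I_5=-\frac{\zeta(3)\pi^2}{48}.$$
   Context: $\zeta$ denotes the Riemann zeta function. *)

(* Defs.v *)
From Stdlib Require Import Reals.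
From Coquelicot Require Import Coquelicot.

Open Scope R_scope.

(* [Rpower a b = exp (b * ln a)] is the real power only for [a > 0]; for
   [1 <= n] the base below is positive on the whole of [0, 1]. *)
Definition I_seq (n : nat) : R :=
  RInt (fun x : R => Rpower (x ^ n + (1 - x) ^ n) (1 / INR n)) 0 1.

(* The Dirichlet series, hence the Riemann zeta function only for real
   [s > 1]; no analytic continuation is involved. *)
Definition zeta (s : R) : R :=
  Series (fun k : nat => 1 / Rpower (INR (S k)) s).

(* Poincare expansion [f n ~ sum_i a i / n ^ i] as [n -> oo].  [sum_f_R0 u K]
   has the [K + 1] terms [u 0, ..., u K].  The constants [C] and [N] may depend
   on [K]. *)
Definition asymptotic_expansion (f : nat -> R) (a : nat -> R) : Prop :=
  forall K : nat, exists (C : R) (N : nat), forall n : nat,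
    (1 <= n)%nat -> (N <= n)%nat ->
    Rabs (f n - sum_f_R0 (fun i : nat => a i / INR n ^ i) K)
      <= C / INR n ^ (S K).

(* Main.v *)
(** The substitution x = 1 / (1 + exp (- u / n)), together with the symmetry
    x <-> 1 - x, gives with e = 1/n
      I(n) - 3/4 = int_0^oo 2 e G (e u) (exp (e p(u)) - 1) du,
    where p(u) = ln (1 + exp (- u)) and G = sigma^2 (1 - sigma) for the logistic
    function sigma.  All derivatives of G are bounded, so expanding G and exp in
    powers of e under the integral sign gives the expansion; its coefficients are
    combinations of the integrals of u^j p^k.

    With q(u) = p(- u) = p(u) + u, the integrands needed up to order 5 are, modulo
    u^2 p in weight 4, combinations of monomials in p and q whose antiderivatives
    are polynomials in p, q, Li_k(sigma(u)) and Li_k(sigma(- u)).  These two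
    families agree at u = 0, while at infinity the former tends to zeta(k) and the
    latter to 0, so only zeta values survive.  The integral of p^2 q^2 needs also
    Euler's sum zeta(4,1) = 2 zeta(5) - zeta(2) zeta(3).  The values of zeta(2) and
    zeta(4) come from Matsuoka's recurrences for the integrals of x^k cos^(2n) x. *)

Require Import Defs.
From Stdlib Require Import Reals Factorial Lra Lia.
From Coquelicot Require Import Coquelicot.

Open Scope R_scope.

(** * Newton integrals over the half-line *)

(** The constant 3/4 is the integral of max(x, 1 - x), the limit of the integrand. Once it is
    removed, the factor exp(e p) - 1 is O(exp(- u)) and makes the remainders integrable, although
    expanding G(e u) at 0 produces powers of u.

    The obstacle is that the integrals of single monomials need not be zeta values: that of p^3,
    equal to the integral of ln(1 + t)^3 / t over [0, 1], involves Li_4(1/2) and ln 2. The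
    coefficients are therefore evaluated as whole combinations, in which these constants cancel. The
    antiderivatives are built from Leibniz ladders: p^k Li_2(sg u) + k p^(k-1) Li_3(sg u) + ... has
    derivative (1 - sg) p^k q, because p' = - (1 - sg) and Li_j(sg u) has derivative (1 - sg)
    Li_(j-1)(sg u). The mirror ladder in q and Li_j(sg(- u)) has derivative - sg q^k p. In weight 4
    the remaining u^2 p is reduced to the integral of u^3 (1 - sg), which a geometric series
    evaluates. *)

(* [f] has an antiderivative on the whole line, and [l] is its increment from [0] to
   [+oo]; integration by parts needs no integrability hypothesis in this form. *)
Definition int_inf (f : R -> R) (l : R) : Prop :=
  exists F : R -> R,
    (forall x, is_derive F x (f x)) /\ is_lim F p_infty (F 0 + l).

Lemma is_derive_nondecreasing (F f : R -> R) (a b : R) :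
  a <= b -> (forall x, is_derive F x (f x)) ->
  (forall x, a <= x -> 0 <= f x) -> F a <= F b.
Proof.
  intros Hab HF Hf.
  destruct (MVT_gen F a b f) as [c [Hc E]].
  - intros x _; apply HF.
  - intros x _. apply continuity_pt_filterlim.
    apply (ex_derive_continuous F). eexists; apply HF.
  - rewrite Rmin_left in Hc by lra. rewrite Rmax_right in Hc by lra.
    assert (0 <= f c * (b - a)) by (apply Rmult_le_pos; [apply Hf|]; lra). lra.
Qed.

Lemma int_inf_ext (f g : R -> R) (l : R) :
  (forall x, f x = g x) -> int_inf f l -> int_inf g l.
Proof.
  intros E [F [HF HL]]. exists F; split; auto. intro x; rewrite <- E; auto.
Qed.

Lemma int_inf_eq (f : R -> R) (l m : R) : int_inf f l -> l = m -> int_inf f m.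
Proof. now intros H <-. Qed.

Lemma int_inf_plus (f g : R -> R) (l m : R) :
  int_inf f l -> int_inf g m -> int_inf (fun x => f x + g x) (l + m).
Proof.
  intros [F [HF LF]] [G [HG LG]].
  exists (fun x => F x + G x). split.
  - intro x. apply (is_derive_plus F G); auto.
  - replace (F 0 + G 0 + (l + m)) with ((F 0 + l) + (G 0 + m)) by ring.
    now apply is_lim_plus'.
Qed.

Lemma int_inf_scal (c : R) (f : R -> R) (l : R) :
  int_inf f l -> int_inf (fun x => c * f x) (c * l).
Proof.
  intros [F [HF LF]]. exists (fun x => c * F x). split.
  - intro x. apply (is_derive_scal F); auto.
  - replace (c * F 0 + c * l) with (c * (F 0 + l)) by ring.
    now apply (is_lim_scal_l F c p_infty (Finite (F 0 + l))).
Qed.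

Lemma int_inf_minus (f g : R -> R) (l m : R) :
  int_inf f l -> int_inf g m -> int_inf (fun x => f x - g x) (l - m).
Proof.
  intros Hf Hg.
  apply int_inf_ext with (fun x => f x + (-1) * g x); [intro; ring|].
  replace (l - m) with (l + (-1) * m) by ring.
  apply int_inf_plus; auto. now apply int_inf_scal.
Qed.

Lemma int_inf_0 : int_inf (fun _ => 0) 0.
Proof.
  exists (fun _ => 0). split.
  - intro x. apply @is_derive_const.
  - rewrite Rplus_0_r. apply is_lim_const.
Qed.

Lemma int_inf_sum (f : nat -> R -> R) (l : nat -> R) (K : nat) :
  (forall i, (i <= K)%nat -> int_inf (f i) (l i)) ->
  int_inf (fun x => sum_f_R0 (fun i => f i x) K) (sum_f_R0 l K).
Proof.
  induction K as [|K IH]; intros H.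
  - apply (H 0%nat); lia.
  - simpl. apply (int_inf_plus _ (f (S K))); [apply IH|apply H]; auto.
Qed.

Lemma int_inf_ge_0 (f : R -> R) (l : R) :
  (forall x, 0 <= x -> 0 <= f x) -> int_inf f l -> 0 <= l.
Proof.
  intros Hf [F [HF LF]].
  assert (H : Rbar_le (F 0) (F 0 + l)).
  { apply is_lim_le_loc with (fun _ => F 0) F p_infty; auto.
    - exists 0. intros x Hx.
      apply is_derive_nondecreasing with f; auto; lra.
    - apply is_lim_const. }
  simpl in H. lra.
Qed.

Lemma int_inf_le (f g : R -> R) (l m : R) :
  (forall x, 0 <= x -> f x <= g x) -> int_inf f l -> int_inf g m -> l <= m.
Proof.
  intros H Hf Hg.
  assert (0 <= m - l); [|lra].
  apply int_inf_ge_0 with (fun x => g x - f x).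
  - intros x Hx. specialize (H x Hx). lra.
  - now apply int_inf_minus.
Qed.

Lemma int_inf_unique (f : R -> R) (l m : R) : int_inf f l -> int_inf f m -> l = m.
Proof.
  intros H1 H2. apply Rle_antisym; eapply int_inf_le; eauto; intros; lra.
Qed.

Lemma int_inf_abs_le (f g : R -> R) (l m : R) :
  (forall x, 0 <= x -> Rabs (f x) <= g x) ->
  int_inf f l -> int_inf g m -> Rabs l <= m.
Proof.
  intros H Hf Hg. apply Rabs_le. split.
  - cut (- m <= l); [auto|].
    replace (- m) with ((-1) * m) by ring.
    apply int_inf_le with (fun x => (-1) * g x) f; auto.
    + intros x Hx. specialize (H x Hx). apply Rabs_le_between in H. lra.
    + now apply int_inf_scal.
  - apply int_inf_le with f g; auto.
    intros x Hx. specialize (H x Hx). apply Rabs_le_between in H. lra.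
Qed.

Lemma is_lim_exp_neg : is_lim (fun u => exp (- u)) p_infty 0.
Proof.
  apply (is_lim_comp exp (fun u => - u) p_infty 0 m_infty).
  - apply is_lim_exp_m.
  - apply (is_lim_opp (fun u => u) p_infty p_infty), is_lim_id.
  - exists 0. intros; discriminate.
Qed.

(** The last term of the Taylor polynomial of degree m of exp at 1 + u is at most exp (1 + u);
    multiplying by exp (- u) leaves the constant exp 1. *)
Lemma poly_exp_bound (m : nat) (u : R) :
  0 <= u -> (1 + u) ^ m * exp (- u) <= INR (fact m) * exp 1.
Proof.
  intro Hu.
  assert (H : (1 + u) ^ m <= INR (fact m) * exp (1 + u)).
  { pose proof (exp_ge_taylor (1 + u) m ltac:(lra)) as H.
    assert (P : 0 < INR (fact m)) by (apply lt_0_INR, lt_O_fact).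
    assert (H2 : (1 + u) ^ m / INR (fact m) <= exp (1 + u)).
    { eapply Rle_trans; [|exact H]. destruct m as [|m]; [simpl; lra|].
      rewrite tech5.
      assert (0 <= sum_f_R0 (fun k => (1 + u) ^ k / INR (fact k)) m).
      { apply cond_pos_sum. intro k.
        apply Rmult_le_pos; [apply pow_le; lra|].
        left; apply Rinv_0_lt_compat, lt_0_INR, lt_O_fact. }
      lra. }
    apply Rmult_le_compat_l with (r := INR (fact m)) in H2; [|lra].
    eapply Rle_trans; [|exact H2]. right; field; lra. }
  apply Rmult_le_compat_r with (r := exp (- u)) in H; [|left; apply exp_pos].
  rewrite Rmult_assoc, <- exp_plus in H.
  now replace (1 + u + - u) with 1 in H by ring.
Qed.

(** The bound with exponent m + 1 has a factor 1 + u to spare, so the function is at most a constant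
    over 1 + u. *)
Lemma is_lim_poly_exp (m : nat) :
  is_lim (fun u => (1 + u) ^ m * exp (- u)) p_infty 0.
Proof.
  assert (Hinv : is_lim (fun u => / (1 + u)) p_infty 0).
  { apply (is_lim_inv (fun u => 1 + u) p_infty p_infty); [|discriminate].
    eapply is_lim_plus; [apply is_lim_const|apply is_lim_id|reflexivity]. }
  apply is_lim_le_le_loc with
    (fun _ => 0) (fun u => INR (fact (S m)) * exp 1 * / (1 + u)).
  - exists 0. intros u Hu. split.
    + apply Rmult_le_pos; [apply pow_le; lra|left; apply exp_pos].
    + pose proof (poly_exp_bound (S m) u ltac:(lra)) as H.
      change ((1 + u) ^ S m) with ((1 + u) * (1 + u) ^ m) in H.
      apply Rmult_le_reg_r with (1 + u); [lra|].
      rewrite !Rmult_assoc, Rinv_l, Rmult_1_r by lra. lra.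
  - apply is_lim_const.
  - replace (Finite 0) with (Rbar_mult (INR (fact (S m)) * exp 1) 0).
    + now apply is_lim_scal_l.
    + simpl. f_equal. ring.
Qed.

Lemma int_inf_poly_exp (m : nat) :
  exists V, int_inf (fun u => (1 + u) ^ m * exp (- u)) V.
Proof.
  induction m as [|m [V HV]].
  - exists 1. exists (fun u => - exp (- u)). split.
    + intro x. auto_derive; auto. simpl; ring.
    + rewrite Ropp_0, exp_0. replace (Finite (- (1) + 1)) with (Rbar_opp 0) by (simpl; f_equal; ring).
      apply (is_lim_opp _ _ 0), is_lim_exp_neg.
  - exists (1 + INR (S m) * V).
    (* Integration by parts: the difference in parentheses is the exact derivative of - (1 +
       u)^(m+1) exp (- u), whose increment is 1. *)
    apply int_inf_ext with (fun u =>
      ((1 + u) ^ S m * exp (- u) - INR (S m) * ((1 + u) ^ m * exp (- u)))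
      + INR (S m) * ((1 + u) ^ m * exp (- u))); [intro; ring|].
    apply int_inf_plus; [|now apply int_inf_scal].
    exists (fun u => - ((1 + u) ^ S m * exp (- u))). split.
    + intro x. auto_derive; auto.
      change (match m with O => 1 | S _ => INR m + 1 end) with (INR (S m)).
      rewrite <- tech_pow_Rmult. ring.
    + rewrite Rplus_0_r, pow1, Ropp_0, exp_0.
      replace (Finite (- (1 * 1) + 1)) with (Rbar_opp 0) by (simpl; f_equal; ring).
      apply (is_lim_opp _ _ 0), is_lim_poly_exp.
Qed.

(** [Lim] is total, so this number means the integral only where convergence is known, as in
    [int_inf_dominated]. It names integrals before, or without, a closed form. *)
Definition Iinf (f : R -> R) : R := real (Lim (fun x => RInt f 0 x) p_infty).

(** With G a primitive of the dominating function, G - F and G + F are nondecreasing on the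
    half-line, so the increments of F are bounded by those of G and F inherits the Cauchy
    property. *)
Lemma int_inf_dominated (f : R -> R) (C : R) (m : nat) :
  (forall x, continuous f x) ->
  (forall u, 0 <= u -> Rabs (f u) <= C * ((1 + u) ^ m * exp (- u))) ->
  int_inf f (Iinf f).
Proof.
  intros Hc Hb.
  destruct (int_inf_poly_exp m) as [V HV].
  apply (int_inf_scal C) in HV. destruct HV as [G [HG LG]].
  set (F := fun x => RInt f 0 x).
  assert (HF : forall x, is_derive F x (f x)).
  { intro x. apply (is_derive_RInt f F 0 x); auto.
    apply filter_forall. intro y.
    apply (@RInt_correct R_CompleteNormedModule), (@ex_RInt_continuous R_CompleteNormedModule).
    auto. }
  assert (Hl : exists l : R, filterlim F (Rbar_locally p_infty) (locally l)).
  { apply (proj1 (@filterlim_locally_cauchy R R_CompleteSpace (Rbar_locally p_infty) _ F)).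
    intro eps.
    assert (Hd : forall x y, 0 <= x -> x <= y -> Rabs (F y - F x) <= G y - G x).
    { intros x y Hx Hxy.
      assert (B : forall u, x <= u ->
        - (C * ((1 + u) ^ m * exp (- u))) <= f u <= C * ((1 + u) ^ m * exp (- u))).
      { intros u Hu. apply Rabs_le_between, Hb. lra. }
      assert (G x - F x <= G y - F y).
      { apply (is_derive_nondecreasing (fun u => G u - F u)
          (fun u => C * ((1 + u) ^ m * exp (- u)) - f u)); auto.
        - intro u. apply (is_derive_minus G F); auto.
        - intros u Hu. specialize (B u Hu). lra. }
      assert (G x + F x <= G y + F y).
      { apply (is_derive_nondecreasing (fun u => G u + F u)
          (fun u => C * ((1 + u) ^ m * exp (- u)) + f u)); auto.
        - intro u. apply (is_derive_plus G F); auto.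
        - intros u Hu. specialize (B u Hu). lra. }
      apply Rabs_le. lra. }
    apply is_lim_spec in LG. simpl in LG.
    destruct (LG (mkposreal (eps / 2) ltac:(destruct eps; simpl; lra))) as [M HM].
    simpl in HM.
    exists (fun x => Rmax 0 M < x). split.
    { exists (Rmax 0 M). auto. }
    intros x y Hx Hy.
    assert (Main : forall a b, Rmax 0 M < a -> Rmax 0 M < b -> a <= b ->
      Rabs (F b - F a) < eps).
    { intros a b Ha Hb' Hab.
      pose proof (Rmax_l 0 M). pose proof (Rmax_r 0 M).
      eapply Rle_lt_trans; [apply Hd; lra|].
      pose proof (HM a ltac:(lra)) as Ga. pose proof (HM b ltac:(lra)) as Gb.
      apply Rabs_lt_between in Ga. apply Rabs_lt_between in Gb. lra. }
    unfold ball; simpl; unfold AbsRing_ball, abs, minus, plus, opp; simpl.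
    change (Rabs (F y - F x) < eps).
    destruct (Rle_dec x y).
    - now apply Main.
    - rewrite Rabs_minus_sym. apply Main; auto; lra. }
  destruct Hl as [l Hl].
  assert (Hl' : is_lim F p_infty l) by exact Hl.
  exists F. split; auto.
  replace (F 0) with 0.
  2:{ unfold F. rewrite RInt_point. reflexivity. }
  rewrite Rplus_0_l. unfold Iinf. fold F.
  rewrite (is_lim_unique _ _ _ Hl'). exact Hl'.
Qed.

(** * The values of zeta(2) and zeta(4) *)

Fixpoint harm (k n : nat) : R :=
  match n with
  | O => 0
  | S m => harm k m + / INR (S m) ^ k
  end.

Definition zeta_nat (k : nat) : R := Series (fun i => / INR (S i) ^ k).

Lemma INR_S_pos (n : nat) : 0 < INR (S n).
Proof. apply lt_0_INR. lia. Qed.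

Lemma harm_sum (k n : nat) : sum_n (fun i => / INR (S i) ^ k) n = harm k (S n).
Proof.
  induction n as [|n IH].
  - rewrite sum_O. simpl harm. symmetry. apply Rplus_0_l.
  - rewrite sum_Sn, IH. reflexivity.
Qed.

Definition cos_moment (k n : nat) : R := RInt (fun x => x ^ k * cos x ^ (2 * n)) 0 (PI / 2).

Lemma is_RInt_cos_moment (k n : nat) :
  is_RInt (fun x => x ^ k * cos x ^ (2 * n)) 0 (PI / 2) (cos_moment k n).
Proof.
  apply (@RInt_correct R_CompleteNormedModule), (@ex_RInt_continuous R_CompleteNormedModule).
  intros x _. apply (ex_derive_continuous (fun x => x ^ k * cos x ^ (2 * n))).
  auto_derive; auto.
Qed.

Lemma cos_moment_pow (k : nat) : cos_moment k 0 = (PI / 2) ^ S k / INR (S k).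
Proof.
  apply is_RInt_unique.
  apply (is_RInt_ext (fun x => x ^ k)).
  - intros x _. simpl. ring.
  - replace ((PI / 2) ^ S k / INR (S k)) with
      (minus ((PI / 2) ^ S k / INR (S k)) (0 ^ S k / INR (S k))).
    2:{ unfold minus, plus, opp; simpl. unfold Rdiv. rewrite !Rmult_0_l. ring. }
    apply (is_RInt_derive (fun x => x ^ S k / INR (S k))).
    + intros x _. auto_derive; auto.
      change (match k with O => 1 | S _ => INR k + 1 end) with (INR (S k)).
      field. pose proof (INR_S_pos k); lra.
    + intros x _. apply (ex_derive_continuous (fun x => x ^ k)). auto_derive; auto.
Qed.

Lemma cos_pow_PI2 (n : nat) : cos (PI / 2) ^ S n = 0.
Proof. rewrite cos_PI2. simpl. ring. Qed.

(* The second derivative of [cos x ^ (2n+2)] is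
   [(2n+2)(2n+1) cos x ^ (2n) - (2n+2)^2 cos x ^ (2n+2)]. *)
Lemma cos_moment_rec0 (n : nat) :
  INR (2 * n + 1) * cos_moment 0 n = INR (2 * n + 2) * cos_moment 0 (S n).
Proof.
  set (N := INR (2 * n + 1)). set (M := INR (2 * n + 2)).
  assert (H1 : is_RInt (fun x => N * (x ^ 0 * cos x ^ (2 * n)) - M * (x ^ 0 * cos x ^ (2 * S n)))
     0 (PI / 2) (N * cos_moment 0 n - M * cos_moment 0 (S n))).
  { apply (is_RInt_minus (V := R_NormedModule)); apply (is_RInt_scal (V := R_NormedModule));
    apply is_RInt_cos_moment. }
  assert (H2 : is_RInt (fun x => N * (x ^ 0 * cos x ^ (2 * n)) - M * (x ^ 0 * cos x ^ (2 * S n)))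
     0 (PI / 2) (minus (- sin (PI / 2) * cos (PI / 2) ^ (2 * n + 1))
                       (- sin 0 * cos 0 ^ (2 * n + 1)))).
  { apply (is_RInt_derive (fun x => - sin x * cos x ^ (2 * n + 1))).
    - intros x _. auto_derive; auto.
      change (n + (n + 0))%nat with (2 * n)%nat.
      fold N. replace (pred (2 * n + 1)) with (2 * n)%nat by lia.
      replace (2 * S n)%nat with (S (S (2 * n))) by lia.
      replace (2 * n + 1)%nat with (S (2 * n)) by lia.
      assert (E : sin x * sin x = 1 - cos x * cos x).
      { pose proof (sin2_cos2 x) as E. unfold Rsqr in E. lra. }
      replace M with (N + 1).
      2:{ unfold M, N. rewrite !plus_INR. simpl. ring. }
      rewrite <- !tech_pow_Rmult. simpl (x ^ 0).
      set (c := cos x ^ (2 * n)).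
      transitivity (N * c * (sin x * sin x) - cos x * (cos x * c)); [ring|].
      rewrite E. ring.
    - intros x _. apply (ex_derive_continuous
        (fun x => N * (x ^ 0 * cos x ^ (2 * n)) - M * (x ^ 0 * cos x ^ (2 * S n)))).
      auto_derive; auto. }
  pose proof (is_RInt_unique _ _ _ _ H1) as E1. rewrite (is_RInt_unique _ _ _ _ H2) in E1.
  replace (2 * n + 1)%nat with (S (2 * n)) in E1 by lia.
  rewrite cos_pow_PI2, sin_0 in E1.
  unfold minus, plus, opp in E1; simpl in E1. lra.
Qed.

Lemma cos_moment_rec (k n : nat) :
  INR (k + 2) * INR (k + 1) * cos_moment k (S n) =
  INR (2 * n + 2) * INR (2 * n + 1) * cos_moment (k + 2) n - INR (2 * n + 2) ^ 2 * cos_moment (k + 2) (S n).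
Proof.
  set (N := INR (2 * n + 1)). set (M := INR (2 * n + 2)).
  set (A := INR (k + 2)). set (B := INR (k + 1)).
  set (f := fun x => M * N * (x ^ (k + 2) * cos x ^ (2 * n))
                     - M ^ 2 * (x ^ (k + 2) * cos x ^ (2 * S n))
                     - A * B * (x ^ k * cos x ^ (2 * S n))).
  assert (H1 : is_RInt f 0 (PI / 2)
    (M * N * cos_moment (k + 2) n - M ^ 2 * cos_moment (k + 2) (S n) - A * B * cos_moment k (S n))).
  { unfold f. apply (is_RInt_minus (V := R_NormedModule)
      (fun x => M * N * (x ^ (k + 2) * cos x ^ (2 * n))
                     - M ^ 2 * (x ^ (k + 2) * cos x ^ (2 * S n)))).
    apply (is_RInt_minus (V := R_NormedModule)).
    all: apply (is_RInt_scal (V := R_NormedModule)); apply is_RInt_cos_moment. }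
  (* Green's formula for h = x^(k+2) and g = cos^(2n+2): [F] is h g' - h' g, with derivative h g'' -
     h'' g. It vanishes at PI/2 through the powers of cos and at 0 through those of x. *)
  set (F := fun x => - M * x ^ (k + 2) * sin x * cos x ^ (2 * n + 1)
                     - A * x ^ (k + 1) * cos x ^ (2 * n + 2)).
  assert (H2 : is_RInt f 0 (PI / 2) (minus (F (PI / 2)) (F 0))).
  { apply (is_RInt_derive F).
    - intros x _. unfold F, f. auto_derive; auto.
      change (n + (n + 0))%nat with (2 * n)%nat.
      fold N M A B.
      replace (pred (2 * n + 1)) with (2 * n)%nat by lia.
      replace (pred (2 * n + 2)) with (S (2 * n)) by lia.
      replace (pred (k + 2)) with (S k) by lia.
      replace (pred (k + 1)) with k by lia.
      replace (k + 2)%nat with (S (S k)) by lia.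
      replace (k + 1)%nat with (S k) by lia.
      replace (2 * S n)%nat with (S (S (2 * n))) by lia.
      replace (2 * n + 1)%nat with (S (2 * n)) by lia.
      replace (2 * n + 2)%nat with (S (S (2 * n))) by lia.
      assert (E : sin x * sin x = 1 - cos x * cos x).
      { pose proof (sin2_cos2 x) as E. unfold Rsqr in E. lra. }
      replace M with (N + 1).
      2:{ unfold M, N. rewrite !plus_INR. simpl. ring. }
      rewrite <- !tech_pow_Rmult.
      set (c := cos x ^ (2 * n)). set (y := x ^ k).
      transitivity ((N + 1) * N * (x * (x * y)) * c * (sin x * sin x)
        - (N + 1) * (x * (x * y)) * c * (cos x * cos x) - A * B * y * c * (cos x * cos x)); [ring|].
      rewrite E. ring.
    - intros x _. apply (ex_derive_continuous f).
      unfold f. auto_derive; auto. }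
  pose proof (is_RInt_unique _ _ _ _ H1) as E1. rewrite (is_RInt_unique _ _ _ _ H2) in E1.
  unfold F in E1.
  replace (2 * n + 1)%nat with (S (2 * n)) in E1 by lia.
  replace (2 * n + 2)%nat with (S (S (2 * n))) in E1 by lia.
  replace (k + 1)%nat with (S k) in E1 by lia.
  replace (k + 2)%nat with (S (S k)) in E1 by lia.
  rewrite !cos_pow_PI2, sin_0, !(pow_i (S _)) in E1 by lia.
  unfold minus, plus, opp in E1; simpl in E1.
  replace (k + 2)%nat with (S (S k)) by lia. simpl. lra.
Qed.

Lemma cos_moment_le (k j n : nat) (c : R) :
  (forall x, 0 < x < PI / 2 -> x ^ k <= c * x ^ j) -> cos_moment k n <= c * cos_moment j n.
Proof.
  intro H. apply (is_RInt_le _ _ 0 (PI / 2) _ _ ltac:(pose proof PI_RGT_0; lra)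
    (is_RInt_cos_moment k n) (is_RInt_scal (V := R_NormedModule) _ _ _ c _ (is_RInt_cos_moment j n))).
  intros x Hx. change (x ^ k * cos x ^ (2 * n) <= c * (x ^ j * cos x ^ (2 * n))).
  rewrite <- Rmult_assoc. apply Rmult_le_compat_r; auto.
  apply pow_le, cos_ge_0; lra.
Qed.

Lemma cos_moment_ge_0 (k n : nat) : 0 <= cos_moment k n.
Proof.
  apply RInt_ge_0.
  - pose proof PI_RGT_0; lra.
  - eexists. apply is_RInt_cos_moment.
  - intros x Hx. apply Rmult_le_pos; apply pow_le; [lra|]. apply cos_ge_0; lra.
Qed.

Lemma cos_moment0_pos (n : nat) : 0 < cos_moment 0 n.
Proof.
  induction n as [|n IH].
  - rewrite cos_moment_pow. pose proof PI_RGT_0. simpl. lra.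
  - pose proof (cos_moment_rec0 n) as E.
    assert (0 < INR (2 * n + 1)) by (apply lt_0_INR; lia).
    assert (0 < INR (2 * n + 2)) by (apply lt_0_INR; lia).
    apply Rmult_lt_reg_l with (INR (2 * n + 2)); auto. rewrite <- E, Rmult_0_r.
    now apply Rmult_lt_0_compat.
Qed.

Lemma x_cos_le_sin (x : R) : 0 <= x <= PI -> x * cos x <= sin x.
Proof.
  intros [H0 H1].
  destruct (MVT_gen (fun x => sin x - x * cos x) 0 x (fun x => x * sin x)) as [c [Hc E]].
  - intros y _. auto_derive; auto. ring.
  - intros y _. apply continuity_pt_filterlim.
    apply (ex_derive_continuous (fun x => sin x - x * cos x)). auto_derive; auto.
  - rewrite Rmin_left, Rmax_right in Hc by lra.
    rewrite sin_0 in E.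
    assert (0 <= c * sin c * (x - 0)).
    { apply Rmult_le_pos; [|lra]. apply Rmult_le_pos; [lra|]. apply sin_ge_0; lra. }
    lra.
Qed.

(** Squaring x cos x <= sin x bounds x^2 cos^(2n+2) by sin^2 cos^(2n), which is cos^(2n) -
    cos^(2n+2). *)
Lemma cos_moment2_le (n : nat) : cos_moment 2 (S n) <= cos_moment 0 n - cos_moment 0 (S n).
Proof.
  pose proof (is_RInt_minus (V := R_NormedModule) _ _ _ _ _ _ (is_RInt_cos_moment 0 n) (is_RInt_cos_moment 0 (S n))) as H.
  apply (is_RInt_le _ _ 0 (PI / 2) _ _ ltac:(pose proof PI_RGT_0; lra)
    (is_RInt_cos_moment 2 (S n)) H).
  intros x Hx. change (x ^ 2 * cos x ^ (2 * S n) <= x ^ 0 * cos x ^ (2 * n) - x ^ 0 * cos x ^ (2 * S n)).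
  replace (2 * S n)%nat with (2 * n + 2)%nat by lia.
  rewrite pow_add, pow_O, !Rmult_1_l.
  assert (E : cos x ^ 2 = 1 - sin x ^ 2).
  { pose proof (sin2_cos2 x) as E. unfold Rsqr in E. simpl. lra. }
  assert (P : 0 <= cos x ^ (2 * n)) by (apply pow_le, cos_ge_0; lra).
  assert (Q : x ^ 2 * cos x ^ 2 <= sin x ^ 2).
  { rewrite <- Rpow_mult_distr. apply pow_incr. split.
    - apply Rmult_le_pos; [lra|apply cos_ge_0; lra].
    - apply x_cos_le_sin. lra. }
  rewrite E in Q |- *. nra.
Qed.

(** Dividing by the moment of order 0 turns the recurrences in n into telescoping differences. *)
Definition cos_ratio (k n : nat) : R := cos_moment k n / cos_moment 0 n.

Lemma cos_ratio_2_rec (n : nat) : cos_ratio 2 n - cos_ratio 2 (S n) = / (2 * INR (S n) ^ 2).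
Proof.
  pose proof (cos_moment_rec 0 n) as E. pose proof (cos_moment_rec0 n) as E0.
  pose proof (cos_moment0_pos n). pose proof (cos_moment0_pos (S n)).
  pose proof (INR_S_pos n).
  unfold cos_ratio.
  replace (INR (2 * n + 2)) with (2 * INR (S n)) in * by (rewrite S_INR, plus_INR, mult_INR; simpl; ring).
  replace (INR (2 * n + 1)) with (2 * INR (S n) - 1) in * by (rewrite S_INR, plus_INR, mult_INR; simpl; ring).
  simpl (INR (0 + 2)) in E. simpl (INR (0 + 1)) in E. simpl (0 + 2)%nat in E.
  set (N := INR (S n)) in *.
  assert (P : 0 < 2 * N - 1).
  { unfold N. rewrite S_INR. pose proof (pos_INR n). lra. }
  assert (E1 : cos_moment 0 n = 2 * N / (2 * N - 1) * cos_moment 0 (S n)).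
  { field_simplify_eq; [|lra]. lra. }
  rewrite E1.
  assert (E2 : cos_moment 2 n = ((1 + 1) * 1 * cos_moment 0 (S n) + (2 * N) ^ 2 * cos_moment 2 (S n)) / (2 * N * (2 * N - 1))).
  { field_simplify_eq; [|lra]. lra. }
  rewrite E2. field. repeat split; lra.
Qed.

Lemma cos_ratio_4_rec (n : nat) : cos_ratio 4 n - cos_ratio 4 (S n) = 3 * cos_ratio 2 (S n) / INR (S n) ^ 2.
Proof.
  pose proof (cos_moment_rec 2 n) as E. pose proof (cos_moment_rec0 n) as E0.
  pose proof (cos_moment0_pos n). pose proof (cos_moment0_pos (S n)).
  pose proof (INR_S_pos n).
  unfold cos_ratio.
  replace (INR (2 * n + 2)) with (2 * INR (S n)) in * by (rewrite S_INR, plus_INR, mult_INR; simpl; ring).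
  replace (INR (2 * n + 1)) with (2 * INR (S n) - 1) in * by (rewrite S_INR, plus_INR, mult_INR; simpl; ring).
  simpl (INR (2 + 2)) in E. simpl (INR (2 + 1)) in E. simpl (2 + 2)%nat in E.
  set (N := INR (S n)) in *.
  assert (P : 0 < 2 * N - 1).
  { unfold N. rewrite S_INR. pose proof (pos_INR n). lra. }
  assert (E1 : cos_moment 0 n = 2 * N / (2 * N - 1) * cos_moment 0 (S n)).
  { field_simplify_eq; [|lra]. lra. }
  rewrite E1.
  assert (E2 : cos_moment 4 n = ((1 + 1 + 1 + 1) * (1 + 1 + 1) * cos_moment 2 (S n) + (2 * N) ^ 2 * cos_moment 4 (S n)) / (2 * N * (2 * N - 1))).
  { field_simplify_eq; [|lra]. lra. }
  rewrite E2. field. repeat split; lra.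
Qed.

Lemma cos_ratio_2 (n : nat) : cos_ratio 2 n = PI ^ 2 / 12 - harm 2 n / 2.
Proof.
  induction n as [|n IH].
  - unfold cos_ratio. rewrite !cos_moment_pow. simpl. pose proof PI_RGT_0. field. lra.
  - pose proof (cos_ratio_2_rec n) as E. rewrite IH in E. simpl harm.
    pose proof (INR_S_pos n).
    assert (E2 : / (2 * INR (S n) ^ 2) = / INR (S n) ^ 2 / 2) by (field; lra).
    simpl in E2, E |- *. lra.
Qed.

(** The start value PI^4/80 is (PI/2)^4 / 5. The increments sum up because sum_{i<=n} [harm 2 i] /
    i^2 is half of [harm 2 n ^ 2 + harm 4 n], by the symmetry of the double sum. *)
Lemma cos_ratio_4 (n : nat) :
  cos_ratio 4 n = PI ^ 4 / 80 - PI ^ 2 / 4 * harm 2 n + 3 / 4 * (harm 2 n ^ 2 + harm 4 n).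
Proof.
  induction n as [|n IH].
  - unfold cos_ratio. rewrite !cos_moment_pow. simpl. pose proof PI_RGT_0. field. lra.
  - pose proof (cos_ratio_4_rec n) as E. rewrite IH, cos_ratio_2 in E. simpl harm in *.
    pose proof (INR_S_pos n).
    set (N := INR (S n)) in *.
    change (match n with O => 1 | S _ => INR n + 1 end) with N in *.
    replace (/ (N * (N * (N * (N * 1))))) with ((/ (N * (N * 1))) ^ 2) by (field; lra).
    assert (E2 : 3 * (PI ^ 2 / 12 - (harm 2 n + / (N * (N * 1))) / 2) / N ^ 2 =
      3 * (PI ^ 2 / 12 - (harm 2 n + / (N * (N * 1))) / 2) * / (N * (N * 1))) by (field; lra).
    rewrite E2 in E.
    set (y := / (N * (N * 1))) in *. nra.
Qed.

Lemma cos_ratio_2_bounds (n : nat) : 0 <= cos_ratio 2 (S n) <= / INR (S n).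
Proof.
  pose proof (cos_moment0_pos n). pose proof (cos_moment0_pos (S n)). pose proof (INR_S_pos n).
  pose proof (cos_moment_rec0 n) as E. pose proof (cos_moment2_le n) as L. pose proof (cos_moment_ge_0 2 (S n)).
  replace (INR (2 * n + 2)) with (2 * INR (S n)) in * by (rewrite S_INR, plus_INR, mult_INR; simpl; ring).
  replace (INR (2 * n + 1)) with (2 * INR (S n) - 1) in * by (rewrite S_INR, plus_INR, mult_INR; simpl; ring).
  unfold cos_ratio. split.
  - apply Rmult_le_pos; auto. left; now apply Rinv_0_lt_compat.
  - set (N := INR (S n)) in *.
    assert (P : 1 <= N).
    { unfold N. rewrite S_INR. pose proof (pos_INR n). lra. }
    apply Rmult_le_reg_r with (cos_moment 0 (S n) * N); [nra|].
    replace (cos_moment 2 (S n) / cos_moment 0 (S n) * (cos_moment 0 (S n) * N)) with (N * cos_moment 2 (S n)) by (field; lra).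
    replace (/ N * (cos_moment 0 (S n) * N)) with (cos_moment 0 (S n)) by (field; lra).
    (* The recurrence of the moments of order 0 makes the difference of two neighbours 1 / (2N - 1)
       times the later one, and 2N - 1 >= N. *)
    assert (Q : (2 * N - 1) * (cos_moment 0 n - cos_moment 0 (S n)) = cos_moment 0 (S n)) by lra.
    nra.
Qed.

Lemma is_lim_seq_inv_INR_S : is_lim_seq (fun n => / INR (S n)) 0.
Proof.
  apply is_lim_seq_spec. intro eps.
  destruct (archimed_cor1 eps (cond_pos eps)) as [N [H1 H2]].
  exists N. intros n Hn. rewrite Rminus_0_r, Rabs_pos_eq.
  - eapply Rle_lt_trans; [|exact H1].
    apply Rinv_le_contravar; [apply lt_0_INR; lia|apply le_INR; lia].
  - left; apply Rinv_0_lt_compat, INR_S_pos.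
Qed.

Lemma is_lim_seq_cos_ratio_2 : is_lim_seq (fun n => cos_ratio 2 (S n)) 0.
Proof.
  apply is_lim_seq_le_le with (fun _ => 0) (fun n => / INR (S n)).
  - apply cos_ratio_2_bounds.
  - apply is_lim_seq_const.
  - apply is_lim_seq_inv_INR_S.
Qed.

Lemma is_lim_seq_cos_ratio_4 : is_lim_seq (fun n => cos_ratio 4 (S n)) 0.
Proof.
  apply is_lim_seq_le_le with (fun _ => 0) (fun n => (PI / 2) ^ 2 * cos_ratio 2 (S n)).
  - intro n. pose proof (cos_moment0_pos (S n)) as P. pose proof (cos_moment_ge_0 4 (S n)).
    unfold cos_ratio. split.
    + apply Rmult_le_pos; auto. left; now apply Rinv_0_lt_compat.
    + unfold Rdiv at 1 3. rewrite <- Rmult_assoc. apply Rmult_le_compat_r.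
      * left; now apply Rinv_0_lt_compat.
      * apply cos_moment_le. intros x Hx.
        replace (x ^ 4) with (x ^ 2 * x ^ 2) by ring.
        apply Rmult_le_compat_r; [apply pow2_ge_0|]. apply pow_incr; lra.
  - apply is_lim_seq_const.
  - replace (Finite 0) with (Rbar_mult ((PI / 2) ^ 2) 0).
    + apply is_lim_seq_scal_l, is_lim_seq_cos_ratio_2.
    + simpl. f_equal. ring.
Qed.

Lemma is_series_harm (k : nat) (l : R) :
  is_lim_seq (harm k) l -> is_series (fun i => / INR (S i) ^ k) l.
Proof.
  intro H. apply is_lim_seq_incr_1 in H.
  apply (is_lim_seq_ext _ _ _ (fun n => eq_sym (harm_sum k n)) H).
Qed.

Lemma is_lim_seq_harm_2 : is_lim_seq (harm 2) (PI ^ 2 / 6).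
Proof.
  apply is_lim_seq_incr_1.
  apply is_lim_seq_ext with (fun n => PI ^ 2 / 6 - 2 * cos_ratio 2 (S n)).
  - intro n. rewrite cos_ratio_2. field.
  - replace (Finite (PI ^ 2 / 6)) with (Finite (PI ^ 2 / 6 - 2 * 0)) by (f_equal; ring).
    apply is_lim_seq_minus'; [apply is_lim_seq_const|].
    apply (is_lim_seq_scal_l _ 2 0), is_lim_seq_cos_ratio_2.
Qed.

Lemma is_lim_seq_harm_4 : is_lim_seq (harm 4) (PI ^ 4 / 90).
Proof.
  apply is_lim_seq_incr_1.
  apply is_lim_seq_ext with (fun n => 4 / 3 * cos_ratio 4 (S n) + (- PI ^ 4 / 60
    + PI ^ 2 / 3 * harm 2 (S n) - harm 2 (S n) * harm 2 (S n))).
  - intro n. rewrite cos_ratio_4. field.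
  - pose proof (proj1 (is_lim_seq_incr_1 _ _) is_lim_seq_harm_2) as H.
    replace (Finite (PI ^ 4 / 90)) with (Finite (4 / 3 * 0 + (- PI ^ 4 / 60
       + PI ^ 2 / 3 * (PI ^ 2 / 6) - PI ^ 2 / 6 * (PI ^ 2 / 6)))) by (f_equal; field).
    apply is_lim_seq_plus'; [apply (is_lim_seq_scal_l _ _ 0), is_lim_seq_cos_ratio_4|].
    apply is_lim_seq_minus'; [apply is_lim_seq_plus'|].
    + apply is_lim_seq_const.
    + now apply (is_lim_seq_scal_l _ _ (PI ^ 2 / 6)).
    + now apply is_lim_seq_mult'.
Qed.

Lemma zeta_nat_2 : zeta_nat 2 = PI ^ 2 / 6.
Proof. apply is_series_unique, is_series_harm, is_lim_seq_harm_2. Qed.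

Lemma zeta_nat_4 : zeta_nat 4 = PI ^ 4 / 90.
Proof. apply is_series_unique, is_series_harm, is_lim_seq_harm_4. Qed.

Lemma inv_INR_S_le_1 (n : nat) : 0 < / INR (S n) <= 1.
Proof.
  pose proof (INR_S_pos n). split; [now apply Rinv_0_lt_compat|].
  rewrite <- Rinv_1. apply Rinv_le_contravar; [lra|]. rewrite S_INR.
  pose proof (pos_INR n); lra.
Qed.

Lemma ex_series_zeta_nat (k : nat) : (2 <= k)%nat -> ex_series (fun i => / INR (S i) ^ k).
Proof.
  intro Hk. apply (@ex_series_le R_AbsRing R_CompleteNormedModule _ (fun i => / INR (S i) ^ 2)).
  - intro n. change (Rabs (/ INR (S n) ^ k) <= / INR (S n) ^ 2).
    pose proof (inv_INR_S_le_1 n).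
    rewrite <- !pow_inv, Rabs_pos_eq by (apply pow_le; lra).
    replace k with (2 + (k - 2))%nat by lia. rewrite pow_add.
    rewrite <- (Rmult_1_r ((/ INR (S n)) ^ 2)) at 2.
    apply Rmult_le_compat_l; [apply pow_le; lra|].
    rewrite <- (pow1 (k - 2)). apply pow_incr. lra.
  - eexists. apply is_series_harm, is_lim_seq_harm_2.
Qed.

Lemma is_lim_seq_harm (k : nat) : (2 <= k)%nat -> is_lim_seq (harm k) (zeta_nat k).
Proof.
  intro Hk. apply is_lim_seq_incr_1.
  apply (is_lim_seq_ext _ _ _ (harm_sum k)).
  apply Series_correct, ex_series_zeta_nat, Hk.
Qed.

Lemma zeta_INR (k : nat) : zeta (INR k) = zeta_nat k.
Proof.
  apply Series_ext. intro n. rewrite Rpower_pow by apply INR_S_pos.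
  unfold Rdiv. ring.
Qed.

(** * Euler's sum *)

Fixpoint psum (f : nat -> R) (n : nat) : R :=
  match n with
  | O => 0
  | S m => psum f m + f m
  end.

Lemma psum_ext (f g : nat -> R) (n : nat) :
  (forall i, (i < n)%nat -> f i = g i) -> psum f n = psum g n.
Proof.
  induction n as [|n IH]; intro H; simpl; auto.
  rewrite IH, H; auto.
Qed.

Lemma psum_le (f g : nat -> R) (n : nat) :
  (forall i, (i < n)%nat -> f i <= g i) -> psum f n <= psum g n.
Proof.
  induction n as [|n IH]; intro H; simpl; [lra|].
  apply Rplus_le_compat; auto.
Qed.

Lemma psum_plus (f g : nat -> R) (n : nat) :
  psum (fun i => f i + g i) n = psum f n + psum g n.
Proof. induction n as [|n IH]; simpl; [ring|]. rewrite IH. ring. Qed.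

Lemma psum_scal (c : R) (f : nat -> R) (n : nat) :
  psum (fun i => c * f i) n = c * psum f n.
Proof. induction n as [|n IH]; simpl; [ring|]. rewrite IH. ring. Qed.

Lemma psum_head (f : nat -> R) (n : nat) :
  psum f (S n) = f O + psum (fun i => f (S i)) n.
Proof. induction n as [|n IH]; [simpl; ring|]. simpl in *. rewrite IH. ring. Qed.

Lemma harm_psum (k n : nat) : harm k n = psum (fun i => / INR (S i) ^ k) n.
Proof. induction n as [|n IH]; simpl; auto. now rewrite IH. Qed.

Lemma harm_rev (n : nat) : psum (fun i => / INR (n - i)) n = harm 1 n.
Proof.
  induction n as [|n IH]; auto.
  rewrite psum_head. rewrite (psum_ext _ (fun i => / INR (n - i))) by (intros; f_equal).
  rewrite IH. simpl harm. rewrite Nat.sub_0_r, Rmult_1_r. simpl. ring.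
Qed.

(* Partial sums of the double series [sum_{m<n} 1 / (n^4 m)]. *)
Definition euler_sum : nat -> R := psum (fun i => harm 1 i / INR (S i) ^ 4).

(** As [harm 1 n - harm 1 (n - m)] is the sum of 1/k for n - m < k <= n, this is the sum of 1/(m^4
    k) over the corner m + k > n of the square 1 <= m, k <= n. *)
Definition euler_rem (n : nat) : R :=
  psum (fun i => (harm 1 n - harm 1 (n - S i)) / INR (S i) ^ 4) n.

Lemma euler_rem_S (n : nat) :
  let M := INR (S n) in
  euler_rem (S n) = euler_rem n + (harm 1 n + / M) / M ^ 4
    - / M * (harm 3 n / M + harm 2 n / M ^ 2 + 2 * harm 1 n / M ^ 3).
Proof.
  intro M. assert (HM : 0 < M) by apply INR_S_pos.
  unfold euler_rem at 1. cbn [psum]. rewrite Nat.sub_diag.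
  replace (harm 1 0) with 0 by reflexivity.
  replace (harm 1 (S n)) with (harm 1 n + / M) by (simpl; fold M; now rewrite Rmult_1_r).
  (* With m = i + 1 and d = M - m = n - i, the increment is (1/M - 1/d) / m^4 = - 1/(M d m^3), and
     partial fractions give 1/(d m^3) = 1/(M m^3) + 1/(M^2 m^2) + 1/(M^3 m) + 1/(M^3 d). *)
  rewrite (psum_ext _ (fun i =>
      (harm 1 n - harm 1 (n - S i)) / INR (S i) ^ 4
      + - / M * (/ M * / INR (S i) ^ 3 + (/ M ^ 2 * / INR (S i) ^ 2
      + (/ M ^ 3 * / INR (S i) ^ 1 + / M ^ 3 * / INR (n - i)))))).
  - rewrite psum_plus, psum_scal, !psum_plus, !psum_scal, harm_rev, <- !harm_psum.
    fold (euler_rem n). fold M. field. lra.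
  - intros i Hi. change (S n - S i)%nat with (n - i)%nat.
    replace (n - i)%nat with (S (n - S i)) at 1 2 by lia. cbn [harm].
    replace (S (n - S i)) with (n - i)%nat by lia. rewrite pow_1.
    pose proof (INR_S_pos i) as Hm.
    assert (Hd : 0 < INR (n - i)) by (apply lt_0_INR; lia).
    assert (E : M = INR (n - i) + INR (S i)).
    { unfold M. rewrite <- plus_INR. f_equal. lia. }
    rewrite E. field. repeat split; lra.
Qed.

(* Finite form of [zeta(4,1) = 2 zeta(5) - zeta(2) zeta(3)], whose error
   [euler_rem] tends to [0]. *)
Lemma euler_sum_eq (n : nat) :
  euler_sum n = 2 * harm 5 n - harm 2 n * harm 3 n - euler_rem n.
Proof.
  induction n as [|n IH].
  - unfold euler_sum, euler_rem. simpl. ring.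
  - rewrite euler_rem_S. unfold euler_sum in *. cbn [psum harm]. rewrite IH.
    pose proof (INR_S_pos n). field. lra.
Qed.

Lemma harm1_diff (a m : nat) :
  0 <= harm 1 (a + m) - harm 1 a <= INR m / INR (S a).
Proof.
  pose proof (INR_S_pos a) as P.
  induction m as [|m IH].
  - rewrite Nat.add_0_r. simpl (INR 0). unfold Rdiv. rewrite Rmult_0_l. lra.
  - rewrite Nat.add_succ_r. cbn [harm]. rewrite pow_1.
    assert (0 < / INR (S (a + m)) <= / INR (S a)).
    { split; [apply Rinv_0_lt_compat, INR_S_pos|].
      apply Rinv_le_contravar; auto. apply le_INR; lia. }
    replace (INR (S m) / INR (S a)) with (INR m / INR (S a) + / INR (S a))
      by (rewrite (S_INR m); field; lra).
    lra.
Qed.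

Lemma euler_rem_bounds (n : nat) : 0 <= euler_rem n <= / INR n * harm 2 n.
Proof.
  split.
  - replace 0 with (psum (fun _ => 0 * 0) n) by (rewrite psum_scal; ring).
    apply psum_le. intros i Hi. rewrite Rmult_0_l.
    apply Rmult_le_pos.
    + pose proof (harm1_diff (n - S i) (S i)) as H.
      replace (n - S i + S i)%nat with n in H by lia. apply H.
    + left. apply Rinv_0_lt_compat, pow_lt, INR_S_pos.
  - rewrite harm_psum, <- psum_scal. apply psum_le. intros i Hi.
    pose proof (harm1_diff (n - S i) (S i)) as H.
    replace (n - S i + S i)%nat with n in H by lia.
    pose proof (INR_S_pos i) as Pi. pose proof (INR_S_pos (n - S i)) as Pa.
    assert (Pn : 0 < INR n) by (apply lt_0_INR; lia).
    apply Rle_trans with (INR (S i) / INR (S (n - S i)) / INR (S i) ^ 4).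
    + apply Rmult_le_compat_r; [|apply H].
      left. now apply Rinv_0_lt_compat, pow_lt.
    + replace (INR (S i) / INR (S (n - S i)) / INR (S i) ^ 4) with
        (/ (INR (S i) * INR (S (n - S i))) * / INR (S i) ^ 2) by (field; lra).
      apply Rmult_le_compat_r; [left; now apply Rinv_0_lt_compat, pow_lt|].
      (* This is n <= m (n - m + 1) for 1 <= m <= n, with m = i + 1. *)
      apply Rinv_le_contravar; auto.
      rewrite <- mult_INR. apply le_INR. nia.
Qed.

Lemma is_lim_seq_euler_sum : is_lim_seq euler_sum (2 * zeta_nat 5 - zeta_nat 2 * zeta_nat 3).
Proof.
  apply is_lim_seq_incr_1.
  apply is_lim_seq_ext with
    (fun n => 2 * harm 5 (S n) - harm 2 (S n) * harm 3 (S n) - euler_rem (S n)).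
  { intro n. now rewrite euler_sum_eq. }
  replace (Finite (2 * zeta_nat 5 - zeta_nat 2 * zeta_nat 3)) with (Finite (2 * zeta_nat 5 - zeta_nat 2 * zeta_nat 3 - 0))
    by (f_equal; ring).
  assert (L : forall k, (2 <= k)%nat -> is_lim_seq (fun n => harm k (S n)) (zeta_nat k)).
  { intros k Hk. apply (is_lim_seq_incr_1 (harm k)), is_lim_seq_harm, Hk. }
  apply is_lim_seq_minus'; [apply is_lim_seq_minus'|].
  - apply (is_lim_seq_scal_l _ 2 (zeta_nat 5)), L. lia.
  - apply is_lim_seq_mult'; apply L; lia.
  - apply is_lim_seq_le_le with (fun _ => 0) (fun n => / INR (S n) * harm 2 (S n)).
    + intro n. apply euler_rem_bounds.
    + apply is_lim_seq_const.
    + replace (Finite 0) with (Finite (0 * zeta_nat 2)) by (f_equal; ring).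
      apply is_lim_seq_mult'; [apply is_lim_seq_inv_INR_S|apply L; lia].
Qed.

(** * Polylogarithms of the logistic function *)

Definition tame (f : R -> R) : Prop :=
  exists C m, 0 <= C /\ forall u, 0 <= u -> Rabs (f u) <= C * (1 + u) ^ m.

(** The polynomial factor makes this class stable under multiplication by tame functions; its
    members still tend to 0, and the continuous ones are integrable over the half-line. *)
Definition decays (f : R -> R) : Prop :=
  exists C m, 0 <= C /\ forall u, 0 <= u -> Rabs (f u) <= C * ((1 + u) ^ m * exp (- u)).

Lemma exp_neg_bounds (u : R) : 0 <= u -> 0 < exp (- u) <= 1.
Proof.
  intro Hu. split; [apply exp_pos|]. rewrite <- exp_0.
  destruct Hu as [Hu|<-]; [left; apply exp_increasing; lra|rewrite Ropp_0; lra].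
Qed.

Lemma pow_ge_1 (u : R) (m : nat) : 0 <= u -> 1 <= (1 + u) ^ m.
Proof. intro Hu. apply pow_R1_Rle. lra. Qed.

Lemma tame_const (c : R) : tame (fun _ => c).
Proof.
  exists (Rabs c), 0%nat. split; [apply Rabs_pos|]. intros. simpl. lra.
Qed.

Lemma tame_id : tame (fun u => u).
Proof.
  exists 1, 1%nat. split; [lra|]. intros u Hu. rewrite Rabs_pos_eq; simpl; lra.
Qed.

Lemma decays_tame (f : R -> R) : decays f -> tame f.
Proof.
  intros [C [m [HC H]]]. exists C, m. split; auto. intros u Hu.
  eapply Rle_trans; [apply H; auto|]. apply Rmult_le_compat_l; auto.
  rewrite <- (Rmult_1_r ((1 + u) ^ m)) at 2.
  pose proof (exp_neg_bounds u Hu). pose proof (pow_ge_1 u m Hu).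
  apply Rmult_le_compat_l; lra.
Qed.

Lemma tame_mult (f g : R -> R) : tame f -> tame g -> tame (fun u => f u * g u).
Proof.
  intros [C [m [HC H]]] [D [k [HD K]]]. exists (C * D), (m + k)%nat.
  split; [now apply Rmult_le_pos|]. intros u Hu.
  rewrite Rabs_mult, pow_add.
  replace (C * D * ((1 + u) ^ m * (1 + u) ^ k)) with ((C * (1 + u) ^ m) * (D * (1 + u) ^ k)) by ring.
  apply Rmult_le_compat; auto using Rabs_pos.
Qed.

Lemma tame_pow (f : R -> R) (k : nat) : tame f -> tame (fun u => f u ^ k).
Proof.
  intro H. induction k as [|k IH]; simpl; [apply tame_const|].
  now apply tame_mult.
Qed.

Lemma decays_mult_l (f g : R -> R) : decays f -> tame g -> decays (fun u => f u * g u).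
Proof.
  intros [C [m [HC H]]] [D [k [HD K]]]. exists (C * D), (m + k)%nat.
  split; [now apply Rmult_le_pos|]. intros u Hu.
  rewrite Rabs_mult, pow_add.
  replace (C * D * ((1 + u) ^ m * (1 + u) ^ k * exp (- u)))
    with ((C * ((1 + u) ^ m * exp (- u))) * (D * (1 + u) ^ k)) by ring.
  apply Rmult_le_compat; auto using Rabs_pos.
Qed.

Lemma decays_ext (f g : R -> R) : (forall u, f u = g u) -> decays f -> decays g.
Proof.
  intros E [C [m [HC H]]]. exists C, m. split; auto. intros u Hu. rewrite <- E; auto.
Qed.

Lemma decays_mult_r (f g : R -> R) : tame f -> decays g -> decays (fun u => f u * g u).
Proof.
  intros Hf Hg. apply decays_ext with (fun u => g u * f u); [intro; ring|].
  now apply decays_mult_l.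
Qed.

Lemma decays_pow (f : R -> R) (k : nat) : decays f -> decays (fun u => f u ^ S k).
Proof.
  intro H. simpl. apply decays_mult_l; auto. now apply tame_pow, decays_tame.
Qed.

Lemma decays_plus (f g : R -> R) : decays f -> decays g -> decays (fun u => f u + g u).
Proof.
  intros [C [m [HC H]]] [D [k [HD K]]]. exists (C + D), (m + k)%nat.
  split; [lra|]. intros u Hu.
  eapply Rle_trans; [apply Rabs_triang|].
  specialize (H u Hu). specialize (K u Hu).
  pose proof (pow_ge_1 u m Hu) as P. pose proof (pow_ge_1 u k Hu) as Q.
  pose proof (exp_neg_bounds u Hu) as E.
  assert (A : C * ((1 + u) ^ m * exp (- u)) <= C * ((1 + u) ^ (m + k) * exp (- u))).
  { apply Rmult_le_compat_l, Rmult_le_compat_r; try lra. rewrite pow_add.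
    rewrite <- (Rmult_1_r ((1 + u) ^ m)) at 1. apply Rmult_le_compat_l; lra. }
  assert (B : D * ((1 + u) ^ k * exp (- u)) <= D * ((1 + u) ^ (m + k) * exp (- u))).
  { apply Rmult_le_compat_l, Rmult_le_compat_r; try lra. rewrite pow_add.
    rewrite <- (Rmult_1_l ((1 + u) ^ k)) at 1. apply Rmult_le_compat_r; lra. }
  lra.
Qed.

Lemma decays_scal (c : R) (f : R -> R) : decays f -> decays (fun u => c * f u).
Proof. intro H. apply decays_mult_r; auto using tame_const. Qed.

Lemma decays_minus (f g : R -> R) : decays f -> decays g -> decays (fun u => f u - g u).
Proof.
  intros Hf Hg. apply decays_ext with (fun u => f u + (-1) * g u); [intro; ring|].
  apply decays_plus; auto using decays_scal.
Qed.

Lemma decays_is_lim (f : R -> R) : decays f -> is_lim f p_infty 0.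
Proof.
  intros [C [m [HC H]]].
  apply is_lim_le_le_loc with
    (fun u => - C * ((1 + u) ^ m * exp (- u))) (fun u => C * ((1 + u) ^ m * exp (- u))).
  - exists 0. intros u Hu. specialize (H u ltac:(lra)).
    apply Rabs_le_between in H. lra.
  - replace (Finite 0) with (Rbar_mult (- C) 0) by (simpl; f_equal; ring).
    apply is_lim_scal_l, is_lim_poly_exp.
  - replace (Finite 0) with (Rbar_mult C 0) by (simpl; f_equal; ring).
    apply is_lim_scal_l, is_lim_poly_exp.
Qed.

Lemma int_inf_decays (f : R -> R) :
  (forall x, continuous f x) -> decays f -> int_inf f (Iinf f).
Proof. intros Hc [C [m [HC H]]]. now apply int_inf_dominated with C m. Qed.

Lemma zero_derive_lim_0 (f : R -> R) :
  (forall x, is_derive f x 0) -> is_lim f p_infty 0 -> forall x, f x = 0.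
Proof.
  intros Hd Hl x.
  assert (E : forall y, f y = f x).
  { intro y. destruct (MVT_gen f x y (fun _ => 0)) as [c [_ E]].
    - intros z _; apply Hd.
    - intros z _. apply continuity_pt_filterlim, (ex_derive_continuous f).
      eexists; apply Hd.
    - lra. }
  assert (L : is_lim f p_infty (f x)).
  { apply is_lim_ext with (fun _ => f x); [now intro y|apply is_lim_const]. }
  apply is_lim_unique in L. apply is_lim_unique in Hl. congruence.
Qed.

(** * The logistic function and power series evaluated at it *)

Definition sg (u : R) : R := / (1 + exp (- u)).
(** This is - ln (sg u); hence [pp (- u)] is - ln (1 - sg u), that is, Li_1 (sg u). *)
Definition pp (u : R) : R := ln (1 + exp (- u)).

Lemma sg_bounds (u : R) : 0 < sg u < 1.
Proof.
  unfold sg. pose proof (exp_pos (- u)). split.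
  - apply Rinv_0_lt_compat; lra.
  - rewrite <- Rinv_1 at 2. apply Rinv_lt_contravar; lra.
Qed.

Lemma sg_opp (u : R) : sg (- u) = 1 - sg u.
Proof.
  unfold sg. rewrite Ropp_involutive, exp_Ropp.
  pose proof (exp_pos u). field. split; lra.
Qed.

Lemma sg_opp_div (u : R) : sg (- u) / sg u = exp (- u).
Proof.
  unfold sg. rewrite Ropp_involutive, exp_Ropp.
  pose proof (exp_pos u). field. split; lra.
Qed.

Lemma is_derive_sg (u : R) : is_derive sg u (sg u * (1 - sg u)).
Proof.
  unfold sg. pose proof (exp_pos (- u)). auto_derive; [lra|].
  field. lra.
Qed.

Lemma is_derive_pp (u : R) : is_derive pp u (- (1 - sg u)).
Proof.
  unfold pp, sg. pose proof (exp_pos (- u)). auto_derive; [lra|]. field. lra.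
Qed.

Lemma pp_opp (u : R) : pp (- u) = pp u + u.
Proof.
  unfold pp. rewrite Ropp_involutive, exp_Ropp.
  pose proof (exp_pos u).
  rewrite <- (ln_exp u) at 3. rewrite <- ln_mult.
  - f_equal. field. lra.
  - apply Rplus_lt_0_compat; [lra|]. now apply Rinv_0_lt_compat.
  - auto.
Qed.

Lemma is_derive_comp_opp (f : R -> R) (u l : R) :
  is_derive f (- u) l -> is_derive (fun x => f (- x)) u (- l).
Proof.
  intro H. replace (- l) with (scal (-1) l).
  2:{ unfold scal; simpl; unfold mult; simpl. ring. }
  apply (is_derive_comp f (fun x => - x)); auto.
  auto_derive; auto.
Qed.

Lemma pp_bounds (u : R) : 0 < pp u <= exp (- u).
Proof.
  unfold pp. pose proof (exp_pos (- u)). split.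
  - rewrite <- ln_1. apply ln_increasing; lra.
  - rewrite <- (ln_exp (exp (- u))) at 2. left. apply ln_increasing; [lra|].
    now apply exp_ineq1; lra.
Qed.

Lemma decays_pp : decays pp.
Proof.
  exists 1, 0%nat. split; [lra|]. intros u Hu. pose proof (pp_bounds u).
  rewrite Rabs_pos_eq; simpl; lra.
Qed.

Lemma tame_pp_opp : tame (fun u => pp (- u)).
Proof.
  exists 1, 1%nat. split; [lra|]. intros u Hu. rewrite pp_opp.
  pose proof (pp_bounds u). pose proof (exp_neg_bounds u Hu).
  rewrite Rabs_pos_eq; simpl; lra.
Qed.

Lemma one_minus_sg_le_exp (u : R) : 1 - sg u <= exp (- u).
Proof.
  rewrite <- sg_opp, <- sg_opp_div. pose proof (sg_bounds u). pose proof (sg_bounds (- u)).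
  rewrite <- (Rmult_1_r (sg (- u))) at 1. unfold Rdiv.
  apply Rmult_le_compat_l; [lra|]. rewrite <- Rinv_1 at 1.
  apply Rinv_le_contravar; lra.
Qed.

Lemma decays_one_minus_sg : decays (fun u => 1 - sg u).
Proof.
  exists 1, 0%nat. split; [lra|]. intros u _.
  pose proof (sg_bounds u). pose proof (one_minus_sg_le_exp u).
  rewrite Rabs_pos_eq, pow_O; lra.
Qed.

Lemma is_lim_sg : is_lim sg p_infty 1.
Proof.
  apply is_lim_ext with (fun u => 1 - (1 - sg u)); [intro u; ring|].
  replace (Finite 1) with (Finite (1 - 0)) by (f_equal; ring).
  apply is_lim_minus'; [apply is_lim_const|].
  apply decays_is_lim, decays_one_minus_sg.
Qed.

Lemma sg_at_left_1 : filterlim sg (Rbar_locally p_infty) (at_left 1).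
Proof.
  intros P HP. unfold at_left, within in HP.
  pose proof (is_lim_sg _ HP) as L. unfold filtermap in *.
  apply (filter_imp _ _ (fun u H => H (proj2 (sg_bounds u))) L).
Qed.

(* Coefficients of [sum_{n >= 1} c (n - 1) / n ^ j * z ^ n]. *)
Definition polylog_coef (c : nat -> R) (j n : nat) : R :=
  match n with
  | O => 0
  | S i => c i / INR (S i) ^ j
  end.

Definition polylog_sg (c : nat -> R) (j : nat) (u : R) : R := PSeries (polylog_coef c j) (sg u).

(** Under this growth one division by n brings the coefficients into [0, 2], so the series has
    radius at least 1. The factor 2 accommodates [harm_coef]. *)
Definition linear_coef (c : nat -> R) : Prop := forall i, 0 <= c i <= 2 * INR (S i).

Lemma polylog_coef_bounds (c : nat -> R) (j n : nat) : linear_coef c -> 0 <= polylog_coef c (S j) n <= 2.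
Proof.
  intro Hc. destruct n as [|i]; cbn [polylog_coef]; [lra|].
  specialize (Hc i). pose proof (inv_INR_S_le_1 i) as B. pose proof (INR_S_pos i) as P.
  rewrite <- (tech_pow_Rmult (INR (S i))).
  replace (c i / (INR (S i) * INR (S i) ^ j)) with (c i / INR (S i) * (/ INR (S i)) ^ j).
  2:{ rewrite pow_inv. field. split; [apply pow_nonzero|]; lra. }
  assert (0 <= c i / INR (S i) <= 2).
  { split.
    - apply Rmult_le_pos; lra.
    - apply Rmult_le_reg_r with (INR (S i)); auto.
      unfold Rdiv. rewrite Rmult_assoc, Rinv_l; lra. }
  assert (0 <= (/ INR (S i)) ^ j <= 1).
  { split; [apply pow_le; lra|]. rewrite <- (pow1 j). apply pow_incr; lra. }
  nra.
Qed.

Lemma bounded_CV_radius (a : nat -> R) (M z : R) :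
  (forall n, Rabs (a n) <= M) -> Rabs z < 1 -> Rbar_lt (Rabs z) (CV_radius a).
Proof.
  intros H Hz. apply Rbar_lt_le_trans with 1; [exact Hz|].
  apply (proj1 (CV_radius_bounded a)). exists M. intro n. now rewrite pow1, Rmult_1_r.
Qed.

Lemma polylog_coef_CV_radius (c : nat -> R) (j : nat) (z : R) :
  linear_coef c -> Rabs z < 1 -> Rbar_lt (Rabs z) (CV_radius (polylog_coef c (S j))).
Proof.
  intros Hc. apply bounded_CV_radius with 2. intro n.
  pose proof (polylog_coef_bounds c j n Hc). rewrite Rabs_pos_eq; lra.
Qed.

Lemma Rabs_sg (u : R) : Rabs (sg u) < 1.
Proof. pose proof (sg_bounds u). rewrite Rabs_pos_eq; lra. Qed.

Lemma polylog_sg_shift (c : nat -> R) (j : nat) (u : R) :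
  polylog_sg c j u = sg u * PSeries (fun n => c n / INR (S n) ^ j) (sg u).
Proof.
  unfold polylog_sg. rewrite <- PSeries_incr_1. apply PSeries_ext. now intros [|n].
Qed.

(** The operator z d/dz lowers the order by one, and z = sg u has derivative z (1 - z). *)
Lemma is_derive_polylog_sg (c : nat -> R) (j : nat) (u : R) :
  linear_coef c -> is_derive (polylog_sg c (S j)) u ((1 - sg u) * polylog_sg c j u).
Proof.
  intro Hc.
  replace ((1 - sg u) * polylog_sg c j u)
    with (scal (sg u * (1 - sg u)) (PSeries (PS_derive (polylog_coef c (S j))) (sg u))).
  - apply (is_derive_comp (PSeries (polylog_coef c (S j))) sg).
    + apply is_derive_PSeries, polylog_coef_CV_radius; auto using Rabs_sg.
    + apply is_derive_sg.
  - rewrite polylog_sg_shift.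
    change (scal (sg u * (1 - sg u)) (PSeries (PS_derive (polylog_coef c (S j))) (sg u)))
      with (sg u * (1 - sg u) * PSeries (PS_derive (polylog_coef c (S j))) (sg u)).
    rewrite (PSeries_ext (PS_derive (polylog_coef c (S j))) (fun n => c n / INR (S n) ^ j)).
    + rewrite (Rmult_comm (sg u)). apply Rmult_assoc.
    + intro n. unfold PS_derive, polylog_coef. pose proof (INR_S_pos n).
      rewrite <- (tech_pow_Rmult (INR (S n))). field.
      split; [apply pow_nonzero|]; lra.
Qed.

Lemma is_derive_polylog_sg_opp (c : nat -> R) (j : nat) (u : R) :
  linear_coef c -> is_derive (fun x => polylog_sg c (S j) (- x)) u (- (sg u * polylog_sg c j (- u))).
Proof.
  intro Hc. apply (is_derive_comp_opp (polylog_sg c (S j))).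
  replace (sg u) with (1 - sg (- u)) by (rewrite sg_opp; ring).
  now apply is_derive_polylog_sg.
Qed.

(** Comparison with 2 z / (1 - z), which is 2 exp u at z = sg u. Read at - u it gives decay; read at
    u it limits the growth to what one factor [pp] absorbs. *)
Lemma polylog_sg_le_exp (c : nat -> R) (j : nat) (u : R) :
  linear_coef c -> Rabs (polylog_sg c (S j) u) <= 2 * exp u.
Proof.
  intro Hc. rewrite polylog_sg_shift. pose proof (sg_bounds u) as B.
  rewrite Rabs_mult, (Rabs_pos_eq (sg u)) by lra.
  assert (H : Rabs (PSeries (fun n => c n / INR (S n) ^ S j) (sg u)) <= 2 * / (1 - sg u)).
  { unfold PSeries.
    assert (G : ex_series (fun n => 2 * sg u ^ n)).
    { apply (ex_series_scal (V := R_NormedModule) 2 (fun n => sg u ^ n)), ex_series_geom, Rabs_sg. }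
    assert (T : forall n, 0 <= Rabs (c n / INR (S n) ^ S j * sg u ^ n) <= 2 * sg u ^ n).
    { intro n. split; [apply Rabs_pos|].
      pose proof (polylog_coef_bounds c j (S n) Hc) as P. unfold polylog_coef in P.
      pose proof (pow_le (sg u) n ltac:(lra)).
      rewrite Rabs_pos_eq; [|now apply Rmult_le_pos].
      apply Rmult_le_compat_r; lra. }
    eapply Rle_trans; [apply Series_Rabs|].
    - apply (ex_series_le (V := R_CompleteNormedModule) _ (fun n => 2 * sg u ^ n)); auto.
      intro n. change (Rabs (Rabs (c n / INR (S n) ^ S j * sg u ^ n)) <= 2 * sg u ^ n).
      rewrite Rabs_Rabsolu. apply T.
    - eapply Rle_trans; [apply Series_le; [exact T|exact G]|].
      rewrite (Series_scal_l 2 (fun n => sg u ^ n)), Series_geom by apply Rabs_sg. lra. }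
  apply Rle_trans with (sg u * (2 * / (1 - sg u))).
  - apply Rmult_le_compat_l; lra.
  - right. pose proof (sg_opp_div (- u)) as E.
    rewrite !Ropp_involutive, sg_opp in E. rewrite <- E. unfold Rdiv. ring.
Qed.

Lemma decays_polylog_sg_opp (c : nat -> R) (j : nat) :
  linear_coef c -> decays (fun u => polylog_sg c (S j) (- u)).
Proof.
  intro Hc. exists 2, 0%nat. split; [lra|]. intros u _. rewrite pow_O, Rmult_1_l.
  now apply polylog_sg_le_exp.
Qed.

Definition dirichlet (c : nat -> R) (j : nat) : nat -> R := fun i => c i / INR (S i) ^ j.

Lemma is_series_polylog_coef (c : nat -> R) (j : nat) (l : R) :
  is_series (dirichlet c j) l -> is_pseries (polylog_coef c j) 1 l.
Proof.
  intro H. unfold is_pseries.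
  apply (is_series_ext (polylog_coef c j)).
  { intro n. rewrite pow_n_pow, pow1. symmetry. apply (scal_one (K := R_Ring)). }
  apply (is_series_decr_1 (K := R_AbsRing) (V := R_NormedModule)).
  match goal with |- is_series _ ?x => replace x with l; [exact H|] end.
  change (l = l + - 0). ring.
Qed.

(** Abel's limit theorem at z = 1, which [sg u] approaches from below; if the radius of convergence
    exceeds 1, continuity at 1 suffices. *)
Lemma polylog_sg_lim (c : nat -> R) (j : nat) :
  linear_coef c -> ex_series (dirichlet c (S j)) ->
  is_lim (polylog_sg c (S j)) p_infty (Series (dirichlet c (S j))).
Proof.
  intros Hc [l Hs]. rewrite (is_series_unique _ _ Hs).
  apply is_series_polylog_coef in Hs.
  assert (E : PSeries (polylog_coef c (S j)) 1 = l) by now apply is_pseries_unique.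
  set (a := polylog_coef c (S j)) in *.
  assert (R1 : Rbar_le 1 (CV_radius a)).
  { apply (proj1 (CV_radius_bounded a)). exists 2. intro n.
    pose proof (polylog_coef_bounds c j n Hc) as B. fold a in B.
    rewrite pow1, Rmult_1_r, Rabs_pos_eq; lra. }
  assert (L : filterlim (PSeries a) (at_left 1) (locally (PSeries a 1))).
  { destruct (Rbar_le_lt_or_eq_dec _ _ R1) as [Hlt|Heq].
    - assert (L : continuity_pt (PSeries a) 1).
      { apply PSeries_continuity. now rewrite Rabs_R1. }
      apply continuity_pt_filterlim in L. intros P HP. specialize (L P HP).
      unfold filtermap, at_left, within in *.
      apply (filter_imp _ _ (fun x H _ => H) L).
    - pose proof (Abel a) as HA. rewrite <- Heq in HA. apply HA; simpl; auto; [lra|].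
      now exists l. }
  rewrite E in L. unfold is_lim.
  apply (filterlim_comp _ _ _ sg (PSeries a) _ (at_left 1)); [apply sg_at_left_1|exact L].
Qed.

Lemma polylog_sg_abs_le_series (c : nat -> R) (j : nat) (u : R) :
  linear_coef c -> ex_series (dirichlet c j) ->
  Rabs (polylog_sg c j u) <= Series (dirichlet c j).
Proof.
  intros Hc Hs. rewrite polylog_sg_shift. pose proof (sg_bounds u) as B.
  fold (dirichlet c j).
  assert (D : forall n, 0 <= dirichlet c j n).
  { intro n. apply Rmult_le_pos; [apply Hc|].
    left. apply Rinv_0_lt_compat, pow_lt, INR_S_pos. }
  assert (T : forall n, 0 <= Rabs (dirichlet c j n * sg u ^ n) <= dirichlet c j n).
  { intro n. split; [apply Rabs_pos|].
    assert (0 <= sg u ^ n <= 1).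
    { split; [apply pow_le; lra|]. rewrite <- (pow1 n). apply pow_incr; lra. }
    specialize (D n). rewrite Rabs_pos_eq by (apply Rmult_le_pos; lra).
    rewrite <- (Rmult_1_r (dirichlet c j n)) at 2. apply Rmult_le_compat_l; lra. }
  assert (H : Rabs (PSeries (dirichlet c j) (sg u)) <= Series (dirichlet c j)).
  { unfold PSeries. eapply Rle_trans; [apply Series_Rabs|now apply Series_le].
    apply (ex_series_le (V := R_CompleteNormedModule) _ (dirichlet c j)); auto.
    intro n. change (Rabs (Rabs (dirichlet c j n * sg u ^ n)) <= dirichlet c j n).
    rewrite Rabs_Rabsolu. apply T. }
  rewrite Rabs_mult, (Rabs_pos_eq (sg u)) by lra.
  pose proof (Rabs_pos (PSeries (dirichlet c j) (sg u))). nra.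
Qed.

Lemma tame_polylog_sg (c : nat -> R) (j : nat) :
  linear_coef c -> ex_series (dirichlet c j) -> tame (polylog_sg c j).
Proof.
  intros Hc Hs. exists (Rabs (Series (dirichlet c j))), 0%nat. split; [apply Rabs_pos|].
  intros u _. rewrite pow_O, Rmult_1_r.
  eapply Rle_trans; [now apply polylog_sg_abs_le_series|]. apply Rle_abs.
Qed.

Definition one_coef (i : nat) : R := 1.
(* [ln (1 - z) ^ 2 = sum_{n >= 1} (2 H_{n-1} / n) z ^ n]. *)
Definition harm_coef (i : nat) : R := 2 * harm 1 i.

Lemma linear_one : linear_coef one_coef.
Proof. intro i. unfold one_coef. rewrite S_INR. pose proof (pos_INR i). lra. Qed.

Lemma linear_harm : linear_coef harm_coef.
Proof.
  intro i. unfold harm_coef.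
  assert (0 <= harm 1 i <= INR i); [|rewrite S_INR; lra].
  induction i as [|i IH]; [simpl; lra|]. cbn [harm]. rewrite pow_1.
  pose proof (inv_INR_S_le_1 i). rewrite (S_INR i) at 3. lra.
Qed.

Lemma dirichlet_one (k : nat) : (2 <= k)%nat -> is_series (dirichlet one_coef k) (zeta_nat k).
Proof.
  intro Hk. apply (is_series_ext (fun i => / INR (S i) ^ k)).
  - intro n. unfold dirichlet, one_coef, Rdiv. now rewrite Rmult_1_l.
  - apply Series_correct, ex_series_zeta_nat, Hk.
Qed.

Lemma ex_dirichlet_harm (k : nat) : (3 <= k)%nat -> ex_series (dirichlet harm_coef k).
Proof.
  intro Hk. apply (ex_series_le (V := R_CompleteNormedModule) _
    (fun i => 2 * / INR (S i) ^ (k - 1))).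
  - intro n. change (Rabs (dirichlet harm_coef k n) <= 2 * / INR (S n) ^ (k - 1)).
    pose proof (linear_harm n) as L. pose proof (INR_S_pos n) as P.
    unfold dirichlet. destruct k as [|k]; [lia|]. rewrite Nat.sub_1_r; simpl pred.
    rewrite <- (tech_pow_Rmult (INR (S n))).
    assert (Q : 0 < INR (S n) ^ k) by now apply pow_lt.
    rewrite Rabs_pos_eq.
    + apply Rmult_le_reg_r with (INR (S n) * INR (S n) ^ k); [nra|].
      field_simplify; lra.
    + apply Rmult_le_pos; [apply L|]. left. apply Rinv_0_lt_compat. nra.
  - apply (ex_series_scal (V := R_NormedModule) 2 (fun i => / INR (S i) ^ (k - 1))).
    apply ex_series_zeta_nat. lia.
Qed.

Lemma dirichlet_harm_4 : is_series (dirichlet harm_coef 4) (2 * (2 * zeta_nat 5 - zeta_nat 2 * zeta_nat 3)).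
Proof.
  apply (is_series_ext (fun i => scal 2 (harm 1 i / INR (S i) ^ 4))).
  { intro n. unfold scal; simpl; unfold mult; simpl. unfold dirichlet, harm_coef. simpl.
    unfold Rdiv. ring. }
  apply (is_series_scal (V := R_NormedModule)).
  pose proof (proj1 (is_lim_seq_incr_1 _ _) is_lim_seq_euler_sum) as H.
  apply (is_lim_seq_ext _ (sum_n (fun i => harm 1 i / INR (S i) ^ 4))) in H; [exact H|].
  intro n. unfold euler_sum. induction n as [|n IH].
  - rewrite sum_O. simpl. apply Rplus_0_l.
  - rewrite sum_Sn, <- IH. reflexivity.
Qed.

(** Li_1 (z) = - ln (1 - z): after u is replaced by - x both sides tend to 0 at infinity, and their
    derivatives agree because the series of order 0 is geometric. *)
Lemma polylog_sg_one (u : R) : polylog_sg one_coef 1 u = pp (- u).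
Proof.
  assert (H : forall x, polylog_sg one_coef 1 (- x) - pp x = 0).
  { apply zero_derive_lim_0.
    - intro x. pose proof (sg_bounds x) as B.
      replace 0 with (- (sg x * polylog_sg one_coef 0 (- x)) - - (1 - sg x)).
      + apply (is_derive_minus (fun x => polylog_sg one_coef 1 (- x)) pp).
        * apply is_derive_polylog_sg_opp, linear_one.
        * apply is_derive_pp.
      + rewrite polylog_sg_shift, sg_opp.
        rewrite (PSeries_ext _ (fun _ => 1)) by (intro n; unfold one_coef; simpl; field).
        unfold PSeries. rewrite (Series_ext _ (fun n => (1 - sg x) ^ n)) by (intro; ring).
        rewrite Series_geom by (rewrite <- sg_opp; apply Rabs_sg).
        field. lra.
    - apply decays_is_lim, decays_minus; [apply decays_polylog_sg_opp, linear_one|apply decays_pp]. }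
  specialize (H (- u)). rewrite Ropp_involutive in H. lra.
Qed.

Lemma polylog_sg_harm_0 (u : R) : (1 - sg u) * polylog_sg harm_coef 0 u = 2 * (sg u * pp (- u)).
Proof.
  rewrite <- polylog_sg_one, !polylog_sg_shift.
  set (z := sg u). assert (Hz : Rabs z < 1) by apply Rabs_sg.
  rewrite (PSeries_ext (fun n => harm_coef n / INR (S n) ^ 0) (PS_scal 2 (harm 1))).
  2:{ intro n. unfold PS_scal, scal; simpl; unfold mult; simpl. unfold harm_coef. field. }
  rewrite PSeries_scal.
  set (b := fun n => one_coef n / INR (S n) ^ 1).
  assert (Eh : forall n, Rabs (b n) <= 1).
  { intro n. unfold b, one_coef. pose proof (inv_INR_S_le_1 n).
    rewrite pow_1, Rabs_pos_eq; unfold Rdiv; rewrite Rmult_1_l; lra. }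
  assert (Rh : Rbar_lt (Rabs z) (CV_radius (harm 1))).
  { rewrite <- (CV_radius_ext (PS_derive (polylog_coef (fun i => harm 1 i) 1)) (harm 1)).
    - rewrite CV_radius_derive. apply polylog_coef_CV_radius; auto.
      intro i. pose proof (linear_harm i) as L. unfold harm_coef in L.
      pose proof (INR_S_pos i). lra.
    - intro n. unfold PS_derive, polylog_coef. rewrite pow_1. pose proof (INR_S_pos n). field. lra. }
  (* The recurrence [harm 1 (S n)] = [harm 1 n] + 1/(n+1), read as an identity of power series;
     solved for the first series it is the generating function Li_1 (z) / (1 - z) of the harmonic
     numbers. *)
  assert (E : PSeries (harm 1) z = z * (PSeries (harm 1) z + PSeries b z)).
  { rewrite <- PSeries_plus.
    - rewrite <- PSeries_incr_1. apply PSeries_ext. intros [|n]; [reflexivity|].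
      unfold PS_incr_1, PS_plus, b, one_coef. cbn [harm]. unfold plus; simpl.
      unfold Rdiv. now rewrite Rmult_1_l.
    - now apply CV_radius_inside.
    - apply CV_radius_inside. now apply bounded_CV_radius with 1. }
  replace (z * PSeries b z) with ((1 - z) * PSeries (harm 1) z) by lra. ring.
Qed.

Lemma polylog_sg_harm (u : R) : polylog_sg harm_coef 1 u = pp (- u) ^ 2.
Proof.
  assert (H : forall x, polylog_sg harm_coef 1 (- x) - pp x ^ 2 = 0).
  { apply zero_derive_lim_0.
    - intro x.
      replace 0 with (- (sg x * polylog_sg harm_coef 0 (- x)) - 2 * pp x * - (1 - sg x)).
      + apply (is_derive_minus (fun x => polylog_sg harm_coef 1 (- x)) (fun x => pp x ^ 2)).
        * apply is_derive_polylog_sg_opp, linear_harm.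
        * replace (2 * pp x * - (1 - sg x)) with (INR 2 * - (1 - sg x) * pp x ^ 1)
            by (simpl; ring).
          apply (is_derive_pow pp 2 x). apply is_derive_pp.
      + pose proof (polylog_sg_harm_0 (- x)) as E. rewrite sg_opp, Ropp_involutive in E. lra.
    - apply decays_is_lim, decays_minus; [apply decays_polylog_sg_opp, linear_harm|].
      apply decays_pow, decays_pp. }
  specialize (H (- u)). rewrite Ropp_involutive in H. lra.
Qed.

(** * Evaluation of the integrals *)

(* [ll j u] and [mm j u] are [Li_j (sg (- u))] and [Li_j (sg u)]; [harm_ll] and
   [harm_mm] are the analogues for the series of [ln (1 - z) ^ 2]. *)
Definition qq (u : R) : R := pp (- u).
Definition ll (j : nat) (u : R) : R := polylog_sg one_coef j (- u).
Definition mm (j : nat) : R -> R := polylog_sg one_coef j.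
Definition harm_ll (j : nat) (u : R) : R := polylog_sg harm_coef j (- u).
Definition harm_mm (j : nat) : R -> R := polylog_sg harm_coef j.

Lemma qq_eq (u : R) : qq u = pp u + u.
Proof. apply pp_opp. Qed.

Lemma is_derive_qq (u : R) : is_derive qq u (sg u).
Proof.
  replace (sg u) with (- - (1 - sg (- u))) by (rewrite sg_opp; ring).
  apply (is_derive_comp_opp pp), is_derive_pp.
Qed.

Lemma is_derive_ll (j : nat) (u : R) : is_derive (ll (S j)) u (- (sg u * ll j u)).
Proof. exact (is_derive_polylog_sg_opp one_coef j u linear_one). Qed.

Lemma is_derive_mm (j : nat) (u : R) : is_derive (mm (S j)) u ((1 - sg u) * mm j u).
Proof. apply is_derive_polylog_sg, linear_one. Qed.

Lemma is_derive_harm_ll (j : nat) (u : R) : is_derive (harm_ll (S j)) u (- (sg u * harm_ll j u)).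
Proof. exact (is_derive_polylog_sg_opp harm_coef j u linear_harm). Qed.

Lemma is_derive_harm_mm (j : nat) (u : R) : is_derive (harm_mm (S j)) u ((1 - sg u) * harm_mm j u).
Proof. apply is_derive_polylog_sg, linear_harm. Qed.

Lemma ll_1 (u : R) : ll 1 u = pp u.
Proof. unfold ll. rewrite polylog_sg_one. now rewrite Ropp_involutive. Qed.

Lemma mm_1 (u : R) : mm 1 u = qq u.
Proof. apply polylog_sg_one. Qed.

Lemma harm_ll_1 (u : R) : harm_ll 1 u = pp u ^ 2.
Proof. unfold harm_ll. rewrite polylog_sg_harm. now rewrite Ropp_involutive. Qed.

Lemma harm_mm_1 (u : R) : harm_mm 1 u = qq u ^ 2.
Proof. apply polylog_sg_harm. Qed.

Lemma ll_mm_0 (j : nat) : ll j 0 = mm j 0.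
Proof. unfold ll. now rewrite Ropp_0. Qed.

Lemma harm_ll_harm_mm_0 (j : nat) : harm_ll j 0 = harm_mm j 0.
Proof. unfold harm_ll. now rewrite Ropp_0. Qed.

Lemma qq_0 : qq 0 = pp 0.
Proof. unfold qq. now rewrite Ropp_0. Qed.

Lemma decays_ll (j : nat) : decays (ll (S j)).
Proof. exact (decays_polylog_sg_opp one_coef j linear_one). Qed.

Lemma decays_harm_ll (j : nat) : decays (harm_ll (S j)).
Proof. exact (decays_polylog_sg_opp harm_coef j linear_harm). Qed.

Lemma tame_qq : tame qq.
Proof. apply tame_pp_opp. Qed.

Lemma tame_mm (j : nat) : tame (mm (S (S j))).
Proof. apply tame_polylog_sg; [apply linear_one|]. eexists. apply dirichlet_one. lia. Qed.

Lemma tame_harm_mm (j : nat) : tame (harm_mm (S (S (S j)))).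
Proof. apply tame_polylog_sg; [apply linear_harm|]. apply ex_dirichlet_harm. lia. Qed.

(* [tame_harm_mm] does not cover [harm_mm 2], but one factor [pp] already
   compensates its growth. *)
Lemma tame_pp_harm_mm (j : nat) : tame (fun u => pp u * harm_mm (S j) u).
Proof.
  exists 2, 0%nat. split; [lra|]. intros u Hu.
  pose proof (pp_bounds u) as B. pose proof (polylog_sg_le_exp harm_coef j u linear_harm) as L.
  fold (harm_mm (S j)) in L. rewrite Rabs_mult, (Rabs_pos_eq (pp u)), pow_O by lra.
  apply Rle_trans with (exp (- u) * (2 * exp u)).
  - apply Rmult_le_compat; auto using Rabs_pos; lra.
  - right. rewrite exp_Ropp. pose proof (exp_pos u). field. lra.
Qed.

Lemma is_lim_mm (j : nat) : is_lim (mm (S (S j))) p_infty (zeta_nat (S (S j))).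
Proof.
  rewrite <- (is_series_unique _ _ (dirichlet_one (S (S j)) ltac:(lia))).
  apply polylog_sg_lim; [apply linear_one|]. eexists. apply dirichlet_one. lia.
Qed.

Lemma is_lim_harm_mm_4 : is_lim (harm_mm 4) p_infty (2 * (2 * zeta_nat 5 - zeta_nat 2 * zeta_nat 3)).
Proof.
  rewrite <- (is_series_unique _ _ dirichlet_harm_4).
  apply polylog_sg_lim; [apply linear_harm|]. eexists. apply dirichlet_harm_4.
Qed.

Lemma is_lim_decays_plus (f g : R -> R) (l : R) :
  decays f -> is_lim g p_infty l -> is_lim (fun u => f u + g u) p_infty l.
Proof.
  intros Hf Hg. replace l with (0 + l) by ring.
  apply is_lim_plus'; auto. now apply decays_is_lim.
Qed.

Lemma is_lim_scal_R (c : R) (f : R -> R) (l : R) :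
  is_lim f p_infty l -> is_lim (fun u => c * f u) p_infty (c * l).
Proof. apply (is_lim_scal_l f c p_infty l). Qed.

(** [lazymatch] commits to the first match, so the branch for [pp u * harm_mm] must precede the
    general product, which would ask for a bound on [harm_mm 2] alone. *)
Ltac tame_tac :=
  lazymatch goal with
  | |- tame (fun _ => ?c) => exact (tame_const c)
  | |- tame (fun u => u) => exact tame_id
  | |- tame (fun u => qq u) => exact tame_qq
  | |- tame (fun u => pp u) => exact (decays_tame _ decays_pp)
  | |- tame (fun u => ll (S ?j) u) => exact (decays_tame _ (decays_ll j))
  | |- tame (fun u => harm_ll (S ?j) u) => exact (decays_tame _ (decays_harm_ll j))
  | |- tame (fun u => mm (S (S ?j)) u) => exact (tame_mm j)
  | |- tame (fun u => harm_mm (S (S (S ?j))) u) => exact (tame_harm_mm j)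
  | |- tame (fun u => pp u * harm_mm (S ?j) u) => exact (tame_pp_harm_mm j)
  | |- tame (fun u => @?f u * @?g u) => apply (tame_mult f g); tame_tac
  | |- tame (fun u => @?f u ^ ?k) => apply (tame_pow f k); tame_tac
  end.

Ltac decays_tac :=
  lazymatch goal with
  | |- decays (fun u => pp u) => exact decays_pp
  | |- decays (fun u => ll (S ?j) u) => exact (decays_ll j)
  | |- decays (fun u => harm_ll (S ?j) u) => exact (decays_harm_ll j)
  | |- decays (fun u => @?f u + @?g u) => apply (decays_plus f g); decays_tac
  | |- decays (fun u => @?f u - @?g u) => apply (decays_minus f g); decays_tac
  | |- decays (fun u => @?f u * @?g u) =>
      first [ apply (decays_mult_r f g); [tame_tac | decays_tac]
            | apply (decays_mult_l f g); [decays_tac | tame_tac] ]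
  | |- decays (fun u => @?f u ^ S ?k) => apply (decays_pow f k); decays_tac
  end.

Lemma Derive_pp (u : R) : Derive (fun x => pp x) u = - (1 - sg u).
Proof. apply is_derive_unique, is_derive_pp. Qed.

Lemma Derive_qq (u : R) : Derive (fun x => qq x) u = sg u.
Proof. apply is_derive_unique, is_derive_qq. Qed.

Lemma Derive_ll (j : nat) (u : R) : Derive (fun x => ll (S j) x) u = - (sg u * ll j u).
Proof. apply is_derive_unique, is_derive_ll. Qed.

Lemma Derive_mm (j : nat) (u : R) : Derive (fun x => mm (S j) x) u = (1 - sg u) * mm j u.
Proof. apply is_derive_unique, is_derive_mm. Qed.

Lemma Derive_harm_ll (j : nat) (u : R) : Derive (fun x => harm_ll (S j) x) u = - (sg u * harm_ll j u).
Proof. apply is_derive_unique, is_derive_harm_ll. Qed.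

Lemma Derive_harm_mm (j : nat) (u : R) : Derive (fun x => harm_mm (S j) x) u = (1 - sg u) * harm_mm j u.
Proof. apply is_derive_unique, is_derive_harm_mm. Qed.

Ltac derive_tac :=
  auto_derive;
  [ repeat split;
    lazymatch goal with
    | |- ex_derive (fun x => pp x) ?u => exact (ex_intro _ _ (is_derive_pp u))
    | |- ex_derive (fun x => qq x) ?u => exact (ex_intro _ _ (is_derive_qq u))
    | |- ex_derive (fun x => ll (S ?j) x) ?u => exact (ex_intro _ _ (is_derive_ll j u))
    | |- ex_derive (fun x => mm (S ?j) x) ?u => exact (ex_intro _ _ (is_derive_mm j u))
    | |- ex_derive (fun x => harm_ll (S ?j) x) ?u => exact (ex_intro _ _ (is_derive_harm_ll j u))
    | |- ex_derive (fun x => harm_mm (S ?j) x) ?u => exact (ex_intro _ _ (is_derive_harm_mm j u))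
    | |- _ => idtac
    end
  | rewrite ?Derive_pp, ?Derive_qq, ?Derive_ll, ?Derive_mm, ?Derive_harm_ll, ?Derive_harm_mm;
    rewrite ?ll_1, ?mm_1, ?harm_ll_1, ?harm_mm_1 ].

(** Here and in the next antiderivatives the last summand is kept apart because it alone survives at
    infinity, and the value at 0 is 0: there [pp] meets [qq], [ll] meets [mm], and the terms
    cancel. *)
Lemma int_pp : int_inf pp (zeta_nat 2 / 2).
Proof.
  exists (fun u => (/ 2 * (pp u * qq u) - / 2 * pp u ^ 2 - / 2 * ll 2 u) + / 2 * mm 2 u). split.
  - intro u. derive_tac. field.
  - rewrite qq_0, ll_mm_0.
    match goal with |- is_lim _ _ (Finite ?x) => replace x with (/ 2 * zeta_nat 2) by field end.
    apply is_lim_decays_plus; [decays_tac|]. apply is_lim_scal_R, is_lim_mm.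
Qed.

(** The ladder in [mm] yields (1 - sg) p q and that in [ll] yields sg p q; the two weights add up to
    1. *)
Lemma int_pp_qq : int_inf (fun u => pp u * qq u) (zeta_nat 3).
Proof.
  exists (fun u => (pp u * mm 2 u - qq u * ll 2 u - ll 3 u) + 1 * mm 3 u). split.
  - intro u. derive_tac. ring.
  - rewrite qq_0, !ll_mm_0.
    match goal with |- is_lim _ _ (Finite ?x) => replace x with (1 * zeta_nat 3) by ring end.
    apply is_lim_decays_plus; [decays_tac|]. apply is_lim_scal_R, is_lim_mm.
Qed.

(** The ladders yield 3 (1 - sg) p^2 q and 3 sg p q^2. The polynomial in p and q is chosen so that
    its derivative completes the weights sg and 1 - sg to 1; its coefficients 2, - 3/2, - 1/2 add up
    to 0, as its vanishing at u = 0 demands. *)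
Lemma int_weight_4 :
  int_inf (fun u => 2 * pp u ^ 3 - 3 * (pp u ^ 2 * qq u) + 3 * (pp u * qq u ^ 2)) (6 * zeta_nat 4).
Proof.
  exists (fun u => (2 * (pp u ^ 3 * qq u) - 3 / 2 * (pp u ^ 2 * qq u ^ 2) - / 2 * pp u ^ 4
    - 3 * (qq u ^ 2 * ll 2 u + 2 * (qq u * ll 3 u) + 2 * ll 4 u)
    + 3 * (pp u ^ 2 * mm 2 u + 2 * (pp u * mm 3 u))) + 6 * mm 4 u). split.
  - intro u. derive_tac. field.
  - rewrite qq_0, !ll_mm_0.
    match goal with |- is_lim _ _ (Finite ?x) => replace x with (6 * zeta_nat 4) by field end.
    apply is_lim_decays_plus; [decays_tac|]. apply is_lim_scal_R, is_lim_mm.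
Qed.

(** The ladders yield - 4 (1 - sg) p^3 q and - 4 sg p q^3; the polynomial part yields the same two
    products with the weights exchanged, and 6 p^2 q^2. *)
Lemma int_weight_5 :
  int_inf (fun u => 6 * (pp u ^ 2 * qq u ^ 2) - 4 * (pp u * qq u ^ 3) - 4 * (pp u ^ 3 * qq u))
    (- 24 * zeta_nat 5).
Proof.
  exists (fun u => (2 * (pp u ^ 2 * qq u ^ 3) - 2 * (pp u ^ 3 * qq u ^ 2)
    + 4 * (qq u ^ 3 * ll 2 u + 3 * (qq u ^ 2 * ll 3 u) + 6 * (qq u * ll 4 u) + 6 * ll 5 u)
    - 4 * (pp u ^ 3 * mm 2 u + 3 * (pp u ^ 2 * mm 3 u) + 6 * (pp u * mm 4 u))) + - 24 * mm 5 u).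
  split.
  - intro u. derive_tac. field.
  - rewrite qq_0, !ll_mm_0.
    match goal with |- is_lim _ _ (Finite ?x) => replace x with (- 24 * zeta_nat 5) by field end.
    apply is_lim_decays_plus; [decays_tac|]. apply is_lim_scal_R, is_lim_mm.
Qed.

(** The same ladders over the series of ln (1 - z)^2, whose lowest step is q^2 instead of q; the
    surviving limit is Euler's sum. *)
Lemma int_pp2_qq2 :
  int_inf (fun u => pp u ^ 2 * qq u ^ 2) (4 * (2 * zeta_nat 5 - zeta_nat 2 * zeta_nat 3)).
Proof.
  exists (fun u => (pp u * (pp u * harm_mm 2 u) + 2 * (pp u * harm_mm 3 u)
    - qq u ^ 2 * harm_ll 2 u - 2 * (qq u * harm_ll 3 u) - 2 * harm_ll 4 u) + 2 * harm_mm 4 u).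
  split.
  - intro u. derive_tac. ring.
  - rewrite qq_0, !harm_ll_harm_mm_0.
    match goal with |- is_lim _ _ (Finite ?x) =>
      replace x with (2 * (2 * (2 * zeta_nat 5 - zeta_nat 2 * zeta_nat 3))) by ring end.
    apply is_lim_decays_plus; [decays_tac|]. apply is_lim_scal_R, is_lim_harm_mm_4.
Qed.

(** * The integral of u^2 p through a Fermi-Dirac integral *)

Lemma decays_exp (c : R) : 1 <= c -> decays (fun u => exp (- (c * u))).
Proof.
  intro Hc. exists 1, 0%nat. split; [lra|]. intros u Hu.
  rewrite Rabs_pos_eq, pow_O, !Rmult_1_l by (left; apply exp_pos).
  destruct (Rle_lt_or_eq_dec (u) (c * u)) as [H|H]; [nra| |].
  - left. apply exp_increasing. lra.
  - rewrite <- H. lra.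
Qed.

Lemma int_cube_exp (c : R) : 1 <= c -> int_inf (fun u => u ^ 3 * exp (- (c * u))) (6 / c ^ 4).
Proof.
  intro Hc.
  exists (fun u => - 1 * ((u ^ 3 / c + 3 * u ^ 2 / c ^ 2 + 6 * u / c ^ 3 + 6 / c ^ 4) * exp (- (c * u)))).
  split.
  - intro u. auto_derive; auto. field. lra.
  - match goal with |- is_lim _ _ (Finite ?x) => replace x with 0 end.
    2:{ replace (- (c * 0)) with 0 by ring. rewrite exp_0. field. lra. }
    apply decays_is_lim, decays_scal.
    apply decays_ext with (fun u => / c * (u ^ 3 * exp (- (c * u)))
      + 3 * / c ^ 2 * (u ^ 2 * exp (- (c * u)))
      + 6 * / c ^ 3 * (u * exp (- (c * u))) + 6 * / c ^ 4 * exp (- (c * u))).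
    { intro u. field. lra. }
    repeat apply decays_plus; apply decays_scal;
      try (apply decays_mult_r; [tame_tac|]); now apply decays_exp.
Qed.

Lemma int_inf_psum (f : nat -> R -> R) (l : nat -> R) (n : nat) :
  (forall i, int_inf (f i) (l i)) ->
  int_inf (fun x => psum (fun i => f i x) n) (psum l n).
Proof.
  intro H. induction n as [|n IH]; simpl; [apply int_inf_0|].
  now apply (int_inf_plus _ (f n)).
Qed.

(** Finite geometric expansion of exp (- u) / (1 + exp (- u)) with its exact remainder, which
    replaces an interchange of sum and integral by an error bound. *)
Lemma one_minus_sg_geom (u : R) (n : nat) :
  1 - sg u = psum (fun k => (-1) ^ k * exp (- (INR (S k) * u))) n
             + (-1) ^ n * exp (- (INR n * u)) * (1 - sg u).
Proof.
  induction n as [|n IH].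
  - simpl. rewrite Rmult_0_l, Ropp_0, exp_0. ring.
  - rewrite IH at 1. cbn [psum]. rewrite <- (tech_pow_Rmult (-1) n).
    replace (exp (- (INR (S n) * u))) with (exp (- (INR n * u)) * exp (- u)).
    2:{ rewrite <- exp_plus. f_equal. rewrite S_INR. ring. }
    assert (E : 1 - sg u = exp (- u) - exp (- u) * (1 - sg u)).
    { rewrite <- sg_opp_div, sg_opp. pose proof (sg_bounds u). field. lra. }
    rewrite E at 1. ring.
Qed.

(** Changing the sign of the terms with even denominators removes 2 / (2j)^4 = (1/8) / j^4 for each
    j <= n. *)
Lemma alternating_harm_4 (n : nat) :
  psum (fun k => (-1) ^ k * / INR (S k) ^ 4) (2 * n) = harm 4 (2 * n) - / 8 * harm 4 n.
Proof.
  induction n as [|n IH]; [simpl; ring|].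
  replace (2 * S n)%nat with (S (S (2 * n))) by lia. cbn [psum harm]. rewrite IH.
  rewrite <- (tech_pow_Rmult (-1)), pow_1_even.
  replace (INR (S (S (2 * n)))) with (2 * INR (S n)).
  2:{ rewrite !S_INR, mult_INR. simpl. ring. }
  pose proof (INR_S_pos n). pose proof (INR_S_pos (2 * n)). field. lra.
Qed.

(** The value is 3! times the alternating zeta value (1 - 2^(-3)) zeta(4), and 6 * 7/8 = 21/4. *)
Lemma int_cube_sg : int_inf (fun u => u ^ 3 * (1 - sg u)) (21 / 4 * zeta_nat 4).
Proof.
  set (f := fun u => u ^ 3 * (1 - sg u)).
  assert (Hf : int_inf f (Iinf f)).
  { apply int_inf_decays.
    - intro x. apply (ex_derive_continuous f). unfold f. auto_derive.
      repeat split. eexists; apply is_derive_sg.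
    - apply decays_mult_r; [tame_tac|apply decays_one_minus_sg]. }
  (* The remainder integrates to at most 6 / (n + 1)^4; the weaker 6 / (n + 1) suffices for the
     limit, which is taken along even n. *)
  assert (B : forall n, Rabs (Iinf f - 6 * psum (fun k => (-1) ^ k * / INR (S k) ^ 4) n)
     <= 6 * / INR (S n)).
  { intro n. pose proof (inv_INR_S_le_1 n) as Bn. pose proof (INR_S_pos n) as Pn.
    apply Rle_trans with (6 / INR (S n) ^ 4).
    - apply (int_inf_abs_le
        (fun u => f u - 6 * psum (fun k => (-1) ^ k * (/ 6 * (u ^ 3 * exp (- (INR (S k) * u))))) n)
        (fun u => u ^ 3 * exp (- (INR (S n) * u)))).
      + intros u Hu. unfold f. rewrite (one_minus_sg_geom u n) at 1.
        replace (psum (fun i => (-1) ^ i * (/ 6 * (u ^ 3 * exp (- (INR (S i) * u))))) n)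
          with (/ 6 * u ^ 3 * psum (fun k => (-1) ^ k * exp (- (INR (S k) * u))) n).
        2:{ rewrite <- psum_scal. apply psum_ext. intros. ring. }
        match goal with |- Rabs ?x <= _ =>
          replace x with ((-1) ^ n * (u ^ 3 * (exp (- (INR n * u)) * (1 - sg u)))) by field end.
        rewrite Rabs_mult, pow_1_abs, Rmult_1_l.
        pose proof (sg_bounds u). pose proof (exp_pos (- (INR n * u))).
        assert (0 <= u ^ 3) by now apply pow_le.
        rewrite Rabs_pos_eq.
        * apply Rmult_le_compat_l; auto.
          replace (- (INR (S n) * u)) with (- (INR n * u) + - u) by (rewrite S_INR; ring).
          rewrite exp_plus. apply Rmult_le_compat_l; [lra|]. apply one_minus_sg_le_exp.
        * apply Rmult_le_pos; auto. apply Rmult_le_pos; lra.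
      + apply (int_inf_minus _ _ _ _ Hf).
        apply (int_inf_scal 6), int_inf_psum. intro k. apply int_inf_scal.
        replace (/ INR (S k) ^ 4) with (/ 6 * (6 / INR (S k) ^ 4))
          by (pose proof (INR_S_pos k); field; lra).
        apply int_inf_scal, int_cube_exp. rewrite S_INR. pose proof (pos_INR k). lra.
      + apply int_cube_exp. rewrite S_INR. pose proof (pos_INR n). lra.
    - unfold Rdiv. apply Rmult_le_compat_l; [lra|]. rewrite <- pow_inv.
      rewrite <- (Rmult_1_r (/ INR (S n))) at 2. rewrite <- (tech_pow_Rmult _ 3).
      apply Rmult_le_compat_l; [lra|]. rewrite <- (pow1 3). apply pow_incr. lra. }
  apply int_inf_eq with (Iinf f); auto.
  assert (L0 : is_lim_seq (fun n => harm 4 (2 * n) - / 8 * harm 4 n) (zeta_nat 4 - / 8 * zeta_nat 4)).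
  { apply is_lim_seq_minus'.
    - apply (is_lim_seq_subseq (harm 4) (zeta_nat 4) (fun n => (2 * n)%nat)).
      + apply eventually_subseq. intro n. lia.
      + apply is_lim_seq_harm. lia.
    - apply (is_lim_seq_scal_l (harm 4) (/ 8) (zeta_nat 4)), is_lim_seq_harm. lia. }
  assert (L1 : is_lim_seq (fun n => Iinf f - 6 * (harm 4 (2 * n) - / 8 * harm 4 n)) 0).
  { apply is_lim_seq_le_le with (fun n => - (6 * / INR (S n))) (fun n => 6 * / INR (S n)).
    - intro n. specialize (B (2 * n)%nat). rewrite alternating_harm_4 in B.
      assert (/ INR (S (2 * n)) <= / INR (S n)).
      { apply Rinv_le_contravar; [apply INR_S_pos|]. apply le_INR. lia. }
      apply Rabs_le_between in B. lra.
    - replace (Finite 0) with (Rbar_opp (Rbar_mult 6 0)) by (simpl; f_equal; ring).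
      apply (proj1 (is_lim_seq_opp _ _)), is_lim_seq_scal_l, is_lim_seq_inv_INR_S.
    - replace (Finite 0) with (Rbar_mult 6 0) by (simpl; f_equal; ring).
      apply is_lim_seq_scal_l, is_lim_seq_inv_INR_S. }
  assert (L2 : is_lim_seq (fun n => Iinf f - 6 * (harm 4 (2 * n) - / 8 * harm 4 n))
     (Iinf f - 6 * (zeta_nat 4 - / 8 * zeta_nat 4))).
  { apply is_lim_seq_minus'; [apply is_lim_seq_const|].
    now apply (is_lim_seq_scal_l _ 6 (zeta_nat 4 - / 8 * zeta_nat 4)). }
  apply is_lim_seq_unique in L1. apply is_lim_seq_unique in L2.
  rewrite L1 in L2. injection L2. lra.
Qed.

Lemma int_u2_pp : int_inf (fun u => u ^ 2 * pp u) (7 / 4 * zeta_nat 4).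
Proof.
  (* Integration by parts: the first difference is the exact derivative of u^3 p / 3. *)
  apply int_inf_ext with
    (fun u => (u ^ 2 * pp u - / 3 * (u ^ 3 * (1 - sg u))) + / 3 * (u ^ 3 * (1 - sg u)));
    [intro; ring|].
  replace (7 / 4 * zeta_nat 4) with (0 + / 3 * (21 / 4 * zeta_nat 4)) by field.
  apply int_inf_plus; [|apply int_inf_scal, int_cube_sg].
  exists (fun u => / 3 * (u ^ 3 * pp u)). split.
  - intro u. derive_tac. field.
  - match goal with |- is_lim _ _ (Finite ?x) => replace x with 0 by field end.
    apply decays_is_lim. decays_tac.
Qed.

(** This is 96 times the integrand of order 3. With q = p + u it equals the combination of
    [int_weight_4] minus 6 u^2 p. *)
Lemma int_coef_3 :
  int_inf (fun u => - 3 * (u ^ 2 * pp u) + 3 * (u * pp u ^ 2) + 2 * pp u ^ 3) (- (9 / 2) * zeta_nat 4).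
Proof.
  apply int_inf_ext with (fun u => (- 6) * (u ^ 2 * pp u) +
    (2 * pp u ^ 3 - 3 * (pp u ^ 2 * qq u) + 3 * (pp u * qq u ^ 2))).
  { intro u. rewrite qq_eq. ring. }
  replace (- (9 / 2) * zeta_nat 4) with (- 6 * (7 / 4 * zeta_nat 4) + 6 * zeta_nat 4) by field.
  apply int_inf_plus; [apply int_inf_scal, int_u2_pp|apply int_weight_4].
Qed.

(** This is 192 times the integrand of order 4. The contributions 24 zeta(5) and - 24 zeta(5)
    cancel, which leaves I_5 a pure product. *)
Lemma int_coef_4 :
  int_inf (fun u => - 4 * (u ^ 3 * pp u) - 3 * (u ^ 2 * pp u ^ 2) + 2 * (u * pp u ^ 3) + pp u ^ 4)
    (- 12 * (zeta_nat 2 * zeta_nat 3)).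
Proof.
  apply int_inf_ext with (fun u => 3 * (pp u ^ 2 * qq u ^ 2) +
    (6 * (pp u ^ 2 * qq u ^ 2) - 4 * (pp u * qq u ^ 3) - 4 * (pp u ^ 3 * qq u))).
  { intro u. rewrite qq_eq. ring. }
  replace (- 12 * (zeta_nat 2 * zeta_nat 3)) with
    (3 * (4 * (2 * zeta_nat 5 - zeta_nat 2 * zeta_nat 3)) + - 24 * zeta_nat 5) by ring.
  apply int_inf_plus; [apply int_inf_scal, int_pp2_qq2|apply int_weight_5].
Qed.

(** * The asymptotic expansion *)

Lemma Derive_n_tower (d : nat -> R -> R) (j : nat) (s : R) :
  (forall j s, is_derive (d j) s (d (S j) s)) -> is_derive_n (d 0%nat) j s (d j s).
Proof.
  intro H. revert s. induction j as [|j IH]; intro s; [reflexivity|].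
  simpl. apply is_derive_ext with (d j); [|apply H].
  intro t. symmetry. apply is_derive_n_unique, IH.
Qed.

(** The successive derivatives enter as a sequence [d], so that closed forms can replace iterated
    [Derive_n]. The factorial of the Lagrange remainder is given away, and y = 0 is separate because
    the Lagrange form asks for a nondegenerate interval. *)
Lemma taylor_tower (d : nat -> R -> R) (K : nat) (M y : R) :
  (forall j s, is_derive (d j) s (d (S j) s)) -> 0 <= y ->
  (forall s, 0 <= s <= y -> Rabs (d (S K) s) <= M) ->
  Rabs (d 0%nat y - sum_f_R0 (fun j => d j 0 / INR (fact j) * y ^ j) K) <= M * y ^ S K.
Proof.
  intros Hd Hy HM. destruct Hy as [Hy|<-].
  - destruct (Taylor_Lagrange (d 0%nat) K 0 y Hy) as [z [Hz E]].
    { intros t _ [|k] _; [exact I|]. eexists. exact (Derive_n_tower d (S k) t Hd). }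
    rewrite E, (sum_eq _ (fun j => d j 0 / INR (fact j) * y ^ j)).
    2:{ intros i _. rewrite (is_derive_n_unique _ _ _ _ (Derive_n_tower d i 0 Hd)), Rminus_0_r.
        unfold Rdiv. ring. }
    rewrite (is_derive_n_unique _ _ _ _ (Derive_n_tower d (S K) z Hd)), Rminus_0_r.
    match goal with |- Rabs (?a + ?b - ?a) <= _ => replace (a + b - a) with b by ring end.
    specialize (HM z ltac:(lra)).
    assert (P : 0 < y ^ S K) by now apply pow_lt.
    assert (F : 1 <= INR (fact (S K))).
    { change 1 with (INR 1). apply le_INR. pose proof (lt_O_fact (S K)). lia. }
    rewrite Rabs_mult, (Rabs_pos_eq (_ / _)).
    2:{ apply Rmult_le_pos; [lra|]. left; apply Rinv_0_lt_compat; lra. }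
    rewrite (Rmult_comm M). apply Rmult_le_compat; auto using Rabs_pos.
    + apply Rmult_le_pos; [lra|]. left; apply Rinv_0_lt_compat; lra.
    + rewrite <- (Rmult_1_r (y ^ S K)) at 2. unfold Rdiv. apply Rmult_le_compat_l; [lra|].
      rewrite <- Rinv_1. apply Rinv_le_contravar; lra.
  - replace (sum_f_R0 _ K) with (d 0%nat 0).
    + rewrite Rminus_diag, Rabs_R0, pow_i by lia. lra.
    + clear HM. induction K as [|K IH]; [simpl; field|].
      rewrite tech5, <- IH, (pow_i (S K)) by lia. ring.
Qed.

(* [sg_deriv j a] is the [j]-th derivative of [sg ^ a]. *)
Fixpoint sg_deriv (j a : nat) (s : R) : R :=
  match j with
  | O => sg s ^ a
  | S j => INR a * (sg_deriv j a s - sg_deriv j (S a) s)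
  end.

Lemma is_derive_sg_deriv (j a : nat) (s : R) : is_derive (sg_deriv j a) s (sg_deriv (S j) a s).
Proof.
  revert a s. induction j as [|j IH]; intros a s.
  - simpl. replace (INR a * (sg s ^ a - sg s * sg s ^ a))
      with (INR a * (sg s * (1 - sg s)) * sg s ^ pred a).
    + apply is_derive_pow, is_derive_sg.
    + destruct a; simpl; ring.
  - change (is_derive (fun s => INR a * (sg_deriv j a s - sg_deriv j (S a) s)) s
      (INR a * (sg_deriv (S j) a s - sg_deriv (S j) (S a) s))).
    apply (is_derive_scal (fun s => sg_deriv j a s - sg_deriv j (S a) s)).
    apply (is_derive_minus (sg_deriv j a) (sg_deriv j (S a))); apply IH.
Qed.

Lemma sg_deriv_bounded (j a : nat) : exists M, forall s, Rabs (sg_deriv j a s) <= M.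
Proof.
  revert a. induction j as [|j IH]; intro a.
  - exists 1. intro s. simpl. pose proof (sg_bounds s).
    rewrite Rabs_pos_eq by (apply pow_le; lra).
    rewrite <- (pow1 a). apply pow_incr. lra.
  - destruct (IH a) as [M HM]. destruct (IH (S a)) as [N HN].
    exists (INR a * (M + N)). intro s. simpl.
    rewrite Rabs_mult, (Rabs_pos_eq (INR a)) by apply pos_INR.
    apply Rmult_le_compat_l; [apply pos_INR|].
    unfold Rminus. eapply Rle_trans; [apply Rabs_triang|]. rewrite Rabs_Ropp.
    specialize (HM s). specialize (HN s). lra.
Qed.

(* The derivatives of [G = sg ^ 2 * (1 - sg)]. *)
Definition G_deriv (j : nat) (s : R) : R := sg_deriv j 2 s - sg_deriv j 3 s.
Definition G_coef (j : nat) : R := G_deriv j 0 / INR (fact j).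

Lemma is_derive_G_deriv (j : nat) (s : R) : is_derive (G_deriv j) s (G_deriv (S j) s).
Proof. apply (is_derive_minus (sg_deriv j 2) (sg_deriv j 3)); apply is_derive_sg_deriv. Qed.

Lemma G_deriv_taylor (K : nat) :
  exists M, 0 <= M /\ forall s, 0 <= s ->
    Rabs (G_deriv 0 s - sum_f_R0 (fun j => G_coef j * s ^ j) K) <= M * s ^ S K.
Proof.
  destruct (sg_deriv_bounded (S K) 2) as [M HM]. destruct (sg_deriv_bounded (S K) 3) as [N HN].
  assert (B : forall s, Rabs (G_deriv (S K) s) <= M + N).
  { intro s. unfold G_deriv, Rminus. eapply Rle_trans; [apply Rabs_triang|].
    rewrite Rabs_Ropp. specialize (HM s). specialize (HN s). lra. }
  exists (M + N). split.
  - eapply Rle_trans; [apply Rabs_pos|apply (B 0)].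
  - intros s Hs. apply taylor_tower; auto using is_derive_G_deriv.
Qed.

(** Taylor coefficients in e of exp(e p) - 1: the subtracted 1 cancels k = 0, so each remaining
    coefficient carries a factor p and decays. *)
Definition exp_coef (k : nat) (u : R) : R :=
  match k with O => 0 | _ => pp u ^ k / INR (fact k) end.

Lemma pp_le_1 (u : R) : 0 <= u -> pp u <= 1.
Proof. intro Hu. pose proof (pp_bounds u). pose proof (exp_neg_bounds u Hu). lra. Qed.

(** For u >= 0 one has p <= 1, hence p^(n+1) <= p <= exp (- u): one factor of p in the remainder
    provides a decay uniform in e. *)
Lemma exp_minus_1_taylor (n : nat) (e u : R) : 0 < e <= 1 -> 0 <= u ->
  Rabs (exp (e * pp u) - 1 - sum_f_R0 (fun k => e ^ k * exp_coef k u) n)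
    <= exp 1 * (e ^ S n * exp (- u)).
Proof.
  intros He Hu. pose proof (pp_bounds u) as P. pose proof (pp_le_1 u Hu) as P1.
  assert (Hp : 0 <= e * pp u <= 1) by nra.
  replace (exp (e * pp u) - 1 - sum_f_R0 (fun k => e ^ k * exp_coef k u) n)
    with (exp (e * pp u) - sum_f_R0 (fun k => exp 0 / INR (fact k) * (e * pp u) ^ k) n).
  2:{ rewrite exp_0. induction n as [|n IH]; [simpl; field|].
      rewrite !tech5. unfold exp_coef at 2. rewrite Rpow_mult_distr.
      unfold Rdiv in *. lra. }
  eapply Rle_trans.
  - apply (taylor_tower (fun _ => exp) n (exp 1) (e * pp u)); [|lra|].
    + intros _ s. apply is_derive_exp.
    + intros s Hs. rewrite Rabs_pos_eq by (left; apply exp_pos).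
      destruct (Rle_lt_or_eq_dec s 1 ltac:(lra)) as [H|H]; [|rewrite H; lra].
      left. now apply exp_increasing.
  - apply Rmult_le_compat_l; [left; apply exp_pos|].
    rewrite Rpow_mult_distr. apply Rmult_le_compat_l; [apply pow_le; lra|].
    rewrite <- tech_pow_Rmult. apply Rle_trans with (pp u * 1); [|lra].
    apply Rmult_le_compat_l; [lra|]. rewrite <- (pow1 n). apply pow_incr. lra.
Qed.

(** A Cauchy product truncated at total degree K, regrouped by the index j of the first factor; the
    second factor is then cut at K - j. *)
Lemma sum_triangle (A B : nat -> R) (e : R) (K : nat) :
  sum_f_R0 (fun i => e ^ i * sum_f_R0 (fun j => A j * B (i - j)%nat) i) K =
  sum_f_R0 (fun j => A j * e ^ j * sum_f_R0 (fun k => e ^ k * B k) (K - j)) K.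
Proof.
  induction K as [|K IH]; [simpl; ring|].
  rewrite tech5, IH, (tech5 (fun j => A j * e ^ j * _) K).
  rewrite (sum_eq (fun j => A j * e ^ j * sum_f_R0 (fun k => e ^ k * B k) (S K - j))
    (fun j => A j * e ^ j * sum_f_R0 (fun k => e ^ k * B k) (K - j)
              + A j * B (S K - j)%nat * e ^ S K) K).
  - rewrite plus_sum, <- (scal_sum (fun j => A j * B (S K - j)%nat)).
    rewrite (tech5 (fun j => A j * B (S K - j)%nat)), Nat.sub_diag.
    simpl (sum_f_R0 _ 0). ring.
  - intros j Hj. replace (S K - j)%nat with (S (K - j)) by lia. rewrite tech5.
    replace (S K) with (j + S (K - j))%nat at 1 by lia. rewrite pow_add. ring.
Qed.

Definition integrand_coef (i : nat) (u : R) : R :=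
  sum_f_R0 (fun j => G_coef j * u ^ j * exp_coef (i - j) u) i.

Lemma integrand_expansion (K : nat) :
  exists C, forall e u, 0 < e <= 1 -> 0 <= u ->
    Rabs (G_deriv 0 (e * u) * (exp (e * pp u) - 1) - sum_f_R0 (fun i => e ^ i * integrand_coef i u) K)
      <= e ^ S K * (C * ((1 + u) ^ S K * exp (- u))).
Proof.
  destruct (G_deriv_taylor K) as [M [HM0 HM]].
  exists (exp 1 * (M + sum_f_R0 (fun j => Rabs (G_coef j)) K)).
  intros e u He Hu. unfold integrand_coef. rewrite (sum_triangle (fun j => G_coef j * u ^ j) (fun k => exp_coef k u) e K).
  set (E := exp (e * pp u) - 1).
  set (T := fun n => sum_f_R0 (fun k => e ^ k * exp_coef k u) n).
  set (X := sum_f_R0 (fun j => G_coef j * (e * u) ^ j) K).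
  assert (Heu : 0 <= e * u) by nra.
  pose proof (exp_pos (- u)) as Pe. pose proof (exp_pos 1) as P1.
  pose proof (pow_ge_1 u (S K) Hu) as PK.
  assert (PeK : 0 < e ^ S K) by (apply pow_lt; lra).
  assert (HE : Rabs E <= exp 1 * exp (- u)).
  { pose proof (exp_minus_1_taylor 0 e u He Hu) as H. simpl in H. fold E in H.
    rewrite Rmult_0_r, Rminus_0_r, Rmult_1_r in H.
    eapply Rle_trans; [exact H|]. apply Rmult_le_compat_l; [lra|].
    rewrite <- (Rmult_1_l (exp (- u))) at 2. apply Rmult_le_compat_r; lra. }
  (* The error splits in two: G is replaced by its Taylor polynomial, and then in the j-th term the
     factor [E] is cut at order K - j, whose error e^(K-j+1) together with e^j has the full order
     e^(K+1). *)
  replace (G_deriv 0 (e * u) * E - _) with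
    ((G_deriv 0 (e * u) - X) * E
     + sum_f_R0 (fun j => G_coef j * (e * u) ^ j * (E - T (K - j)%nat)) K).
  2:{ unfold X.
      rewrite (sum_eq (fun j => G_coef j * (e * u) ^ j * (E - T (K - j)%nat))
        (fun j => G_coef j * (e * u) ^ j * E - G_coef j * u ^ j * e ^ j * T (K - j)%nat)).
      2:{ intros j _. rewrite Rpow_mult_distr. ring. }
      rewrite minus_sum, <- scal_sum. ring. }
  eapply Rle_trans; [apply Rabs_triang|].
  assert (H1 : Rabs ((G_deriv 0 (e * u) - X) * E)
    <= e ^ S K * (exp 1 * M * ((1 + u) ^ S K * exp (- u)))).
  { rewrite Rabs_mult.
    apply Rle_trans with (M * (e * u) ^ S K * (exp 1 * exp (- u))).
    - apply Rmult_le_compat; auto using Rabs_pos.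
    - rewrite Rpow_mult_distr.
      replace (M * (e ^ S K * u ^ S K) * (exp 1 * exp (- u))) with
        (e ^ S K * (exp 1 * M * (u ^ S K * exp (- u)))) by ring.
      apply Rmult_le_compat_l; [lra|]. apply Rmult_le_compat_l; [nra|].
      apply Rmult_le_compat_r; [lra|]. apply pow_incr. lra. }
  assert (H2 : Rabs (sum_f_R0 (fun j => G_coef j * (e * u) ^ j * (E - T (K - j)%nat)) K)
    <= e ^ S K * (exp 1 * sum_f_R0 (fun j => Rabs (G_coef j)) K * ((1 + u) ^ S K * exp (- u)))).
  { eapply Rle_trans; [apply Rsum_abs|].
    replace (e ^ S K * (exp 1 * sum_f_R0 (fun j => Rabs (G_coef j)) K * ((1 + u) ^ S K * exp (- u))))
      with (e ^ S K * exp 1 * ((1 + u) ^ S K * exp (- u)) * sum_f_R0 (fun j => Rabs (G_coef j)) K)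
      by ring.
    rewrite scal_sum. apply sum_Rle. intros j Hj.
    rewrite Rabs_mult, Rabs_mult, Rmult_assoc. apply Rmult_le_compat_l; [apply Rabs_pos|].
    rewrite (Rabs_pos_eq ((e * u) ^ j)) by now apply pow_le.
    apply Rle_trans with ((e * u) ^ j * (exp 1 * (e ^ S (K - j) * exp (- u)))).
    - apply Rmult_le_compat_l; [now apply pow_le|]. now apply exp_minus_1_taylor.
    - replace (S K) with (j + S (K - j))%nat at 1 by lia.
      rewrite Rpow_mult_distr, pow_add.
      replace (e ^ j * u ^ j * (exp 1 * (e ^ S (K - j) * exp (- u))))
        with (e ^ j * e ^ S (K - j) * exp 1 * (u ^ j * exp (- u))) by ring.
      apply Rmult_le_compat_l.
      { apply Rmult_le_pos; [|lra]. apply Rmult_le_pos; apply pow_le; lra. }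
      apply Rmult_le_compat_r; [lra|].
      apply Rle_trans with ((1 + u) ^ j); [apply pow_incr; lra|].
      apply Rle_pow; [lra|lia]. }
  replace (e ^ S K * (exp 1 * (M + sum_f_R0 (fun j => Rabs (G_coef j)) K) * ((1 + u) ^ S K * exp (- u))))
    with (e ^ S K * (exp 1 * M * ((1 + u) ^ S K * exp (- u)))
      + e ^ S K * (exp 1 * sum_f_R0 (fun j => Rabs (G_coef j)) K * ((1 + u) ^ S K * exp (- u)))) by ring.
  now apply Rplus_le_compat.
Qed.

Definition integral_coef (i : nat) : R :=
  sum_f_R0 (fun j => G_coef j * Iinf (fun u => u ^ j * exp_coef (i - j) u)) i.

Lemma int_integrand_coef (i : nat) : int_inf (integrand_coef i) (integral_coef i).
Proof.
  apply int_inf_sum. intros j _.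
  apply int_inf_ext with (fun u => G_coef j * (u ^ j * exp_coef (i - j) u)); [intro; ring|].
  apply int_inf_scal, int_inf_decays.
  - intro x. apply (ex_derive_continuous (fun u => u ^ j * exp_coef (i - j) u)).
    destruct (i - j)%nat as [|k]; unfold exp_coef; auto_derive; auto.
    repeat split. eexists. apply is_derive_pp.
  - apply decays_mult_r; [apply tame_pow, tame_id|].
    destruct (i - j)%nat as [|k]; unfold exp_coef.
    + apply decays_ext with (fun u => 0 * pp u); [intro; ring|].
      apply decays_scal, decays_pp.
    + apply (decays_mult_l (fun u => pp u ^ S k) (fun _ => / INR (fact (S k)))).
      * apply decays_pow, decays_pp.
      * apply tame_const.
Qed.

(** * The change of variables *)

Lemma pow_S_lt (a b : R) (n : nat) : 0 <= a < b -> a ^ S n < b ^ S n.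
Proof.
  intro H. induction n as [|n IH]; [simpl; lra|].
  rewrite <- (tech_pow_Rmult a), <- (tech_pow_Rmult b).
  apply Rmult_le_0_lt_compat; auto; try lra. apply pow_le; lra.
Qed.

Lemma pow_sum_pos (x y : R) (n : nat) : y < 0 -> 0 < x + y -> 0 < x ^ S n + y ^ S n.
Proof.
  intros Hy Hxy.
  pose proof (pow_S_lt (- y) x n ltac:(lra)) as H.
  assert (Rabs (y ^ S n) = (- y) ^ S n).
  { rewrite <- RPow_abs. now rewrite Rabs_left. }
  pose proof (Rabs_le_between (y ^ S n) ((- y) ^ S n)) as [B _].
  specialize (B ltac:(lra)). lra.
Qed.

(** As x + (1 - x) > 0, a negative summand is outweighed by the other one. Positivity on the whole
    line makes the integrand continuous there and its primitive differentiable everywhere. *)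
Lemma base_pos (n : nat) (x : R) : 0 < x ^ S n + (1 - x) ^ S n.
Proof.
  destruct (Rlt_dec x 0) as [H|H].
  { rewrite Rplus_comm. apply pow_sum_pos; lra. }
  destruct (Rlt_dec (1 - x) 0) as [H1|H1].
  { apply pow_sum_pos; lra. }
  pose proof (pow_le x (S n) ltac:(lra)). pose proof (pow_le (1 - x) (S n) ltac:(lra)).
  destruct (Rlt_dec 0 x).
  - pose proof (pow_lt x (S n) ltac:(lra)). lra.
  - pose proof (pow_lt (1 - x) (S n) ltac:(lra)). lra.
Qed.

(** Since (1 - sg s) / sg s = exp (- s), raising this ratio at s = e u to the power 1/e gives exp (-
    u), which is free of n. *)
Lemma Rpower_base_sg (n : nat) (u : R) :
  let e := / INR (S n) in
  Rpower (sg (e * u) ^ S n + (1 - sg (e * u)) ^ S n) (1 / INR (S n))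
    = sg (e * u) * exp (e * pp u).
Proof.
  intro e. pose proof (INR_S_pos n) as P. pose proof (sg_bounds (e * u)) as B.
  replace (sg (e * u) ^ S n + (1 - sg (e * u)) ^ S n) with (sg (e * u) ^ S n * (1 + exp (- u))).
  2:{ replace (exp (- u)) with (exp (- (e * u)) ^ S n).
      - rewrite <- sg_opp_div, sg_opp. unfold Rdiv. rewrite Rpow_mult_distr, pow_inv.
        field. apply pow_nonzero. lra.
      - rewrite <- Rpower_pow by apply exp_pos. unfold Rpower. rewrite ln_exp.
        f_equal. unfold e. field. lra. }
  pose proof (exp_pos (- u)) as Pu.
  unfold Rpower. rewrite ln_mult by (try apply pow_lt; lra).
  rewrite ln_pow by lra.
  replace (1 / INR (S n) * (INR (S n) * ln (sg (e * u)) + ln (1 + exp (- u))))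
    with (ln (sg (e * u)) + e * pp u) by (unfold e, pp; field; lra).
  rewrite exp_plus, exp_ln by lra. reflexivity.
Qed.

Lemma is_lim_scale (e : R) (F : (R -> Prop) -> Prop) (f : R -> R) :
  0 < e -> filterlim f (Rbar_locally p_infty) F ->
  filterlim (fun u => f (e * u)) (Rbar_locally p_infty) F.
Proof.
  intros He Hf. apply (filterlim_comp _ _ _ (fun u => e * u) f _ (Rbar_locally p_infty)); auto.
  intros P [M HM]. exists (M / e). intros x Hx. apply HM.
  apply Rmult_lt_compat_l with (r := e) in Hx; auto.
  replace (e * (M / e)) with M in Hx by (field; lra). exact Hx.
Qed.

Lemma sg_0 : sg 0 = / 2.
Proof. unfold sg. rewrite Ropp_0, exp_0. f_equal. Qed.

(* The substitution [x = 1 / (1 + exp (- u / n))] for [x >= 1/2], doubled by the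
   symmetry [x <-> 1 - x]. *)
Lemma int_I_seq (n : nat) :
  let e := / INR (S n) in
  int_inf (fun u => 2 * e * (G_deriv 0 (e * u) * (exp (e * pp u) - 1))) (I_seq (S n) - 3 / 4).
Proof.
  intro e. assert (He : 0 < e) by (apply Rinv_0_lt_compat, INR_S_pos).
  set (f := fun x => Rpower (x ^ S n + (1 - x) ^ S n) (1 / INR (S n))).
  assert (Cf : forall x, continuous f x).
  { intro x. apply (ex_derive_continuous f). pose proof (base_pos n x) as B.
    exists (Derive f x). unfold f, Rpower. apply Derive_correct.
    apply ex_derive_comp; [eexists; apply is_derive_exp|].
    apply (ex_derive_scal (fun x => ln (x ^ S n + (1 - x) ^ S n))).
    apply ex_derive_comp; [eexists; now apply is_derive_ln|].
    auto_derive; auto. }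
  set (F := fun x => RInt f 0 x).
  assert (DF : forall x, is_derive F x (f x)).
  { intro x. apply (is_derive_RInt f F 0 x); auto.
    apply filter_forall. intro y.
    apply (@RInt_correct R_CompleteNormedModule), (@ex_RInt_continuous R_CompleteNormedModule).
    auto. }
  assert (CF : forall x, filterlim F (locally x) (locally (F x))).
  { intro x. apply (ex_derive_continuous F). eexists; apply DF. }
  assert (Sf : forall x, f (1 - x) = f x).
  { intro x. unfold f. f_equal. replace (1 - (1 - x)) with x by ring. ring. }
  assert (DS : forall u, is_derive (fun u => sg (e * u)) u (e * (sg (e * u) * (1 - sg (e * u))))).
  { intro u. apply (is_derive_comp sg (fun u => e * u)); [apply is_derive_sg|].
    auto_derive; auto. ring. }
  assert (DS1 : forall u, is_derive (fun u => 1 - sg (e * u)) u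
    (0 - e * (sg (e * u) * (1 - sg (e * u))))).
  { intro u. apply (is_derive_minus (fun _ => 1)); [apply @is_derive_const|apply DS]. }
  (* The two values of [F] integrate over [1 - sg, sg], both halves at once. The square is the
     primitive of 2 max(x, 1 - x) for x >= 1/2: it produces the - 1 after the exponential, and its
     increment from 1/4 to 1 is the 3/4. *)
  exists (fun u => F (sg (e * u)) - F (1 - sg (e * u)) - sg (e * u) ^ 2). split.
  - intro u.
    pose proof (is_derive_minus _ _ u _ _ (is_derive_minus _ _ u _ _
      (is_derive_comp F _ u _ _ (DF _) (DS u)) (is_derive_comp F _ u _ _ (DF _) (DS1 u)))
      (is_derive_pow _ 2 u _ (DS u))) as H.
    cbv beta in H. rewrite Sf in H.
    assert (Ef : f (sg (e * u)) = sg (e * u) * exp (e * pp u)) by apply Rpower_base_sg.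
    rewrite Ef in H.
    match type of H with is_derive _ _ ?l =>
      replace (2 * e * (G_deriv 0 (e * u) * (exp (e * pp u) - 1))) with l; [exact H|] end.
    set (d := e * (sg (e * u) * (1 - sg (e * u)))).
    change (d * (sg (e * u) * exp (e * pp u)) - (0 - d) * (sg (e * u) * exp (e * pp u))
            - INR 2 * d * sg (e * u) ^ 1 = 2 * e * (G_deriv 0 (e * u) * (exp (e * pp u) - 1))).
    unfold G_deriv, sg_deriv, d. simpl INR. ring.
  - rewrite Rmult_0_r.
    rewrite sg_0.
    replace (1 - / 2) with (/ 2) by field.
    match goal with |- is_lim _ _ (Finite ?x) => replace x with (F 1 - F 0 - 1 * 1) end.
    2:{ unfold F at 2. rewrite RInt_point. unfold F, f. fold (I_seq (S n)).
        change zero with 0. field. }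
    assert (L1 : is_lim (fun u => sg (e * u)) p_infty 1) by exact (is_lim_scale e _ sg He is_lim_sg).
    assert (L0 : is_lim (fun u => 1 - sg (e * u)) p_infty 0).
    { replace 0 with (1 - 1) by ring. apply is_lim_minus'; auto. apply is_lim_const. }
    apply is_lim_minus'; [apply is_lim_minus'|].
    + apply (filterlim_comp _ _ _ (fun u => sg (e * u)) F _ (locally 1)); auto.
    + apply (filterlim_comp _ _ _ (fun u => 1 - sg (e * u)) F _ (locally 0)); auto.
    + apply is_lim_ext with (fun u => sg (e * u) * sg (e * u)); [intro; ring|].
      apply (is_lim_mult _ _ p_infty 1 1); auto. exact I.
Qed.

(** The prefactor 2 e of the integral shifts the index by one. *)
Definition I_coef (i : nat) : R :=
  match i with O => 3 / 4 | S i => 2 * integral_coef i end.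

(** [integral_coef] is assembled from separate integrals of u^j p^k; uniqueness of the integral
    permits evaluating their combination as a whole. *)
Lemma integral_coef_eq (i : nat) (f : R -> R) (c l : R) :
  (forall u, integrand_coef i u = c * f u) -> int_inf f l -> integral_coef i = c * l.
Proof.
  intros E H. apply (int_inf_unique (integrand_coef i)); [apply int_integrand_coef|].
  apply int_inf_ext with (fun u => c * f u); [intro; now rewrite E|].
  now apply int_inf_scal.
Qed.

Lemma G_coef_0 : G_coef 0 = / 8.
Proof. unfold G_coef, G_deriv, sg_deriv. rewrite sg_0. simpl. field. Qed.
Lemma G_coef_1 : G_coef 1 = / 16.
Proof. unfold G_coef, G_deriv, sg_deriv. rewrite sg_0. simpl. field. Qed.
Lemma G_coef_2 : G_coef 2 = - / 32.
Proof. unfold G_coef, G_deriv, sg_deriv. rewrite sg_0. simpl. field. Qed.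
Lemma G_coef_3 : G_coef 3 = - / 48.
Proof. unfold G_coef, G_deriv, sg_deriv. rewrite sg_0. simpl. field. Qed.

Lemma integral_coef_0 : integral_coef 0 = 0.
Proof.
  rewrite (integral_coef_eq 0 (fun _ => 0) 0 0).
  - ring.
  - intro u. unfold integrand_coef; simpl. ring.
  - apply int_inf_0.
Qed.

Lemma integral_coef_1 : integral_coef 1 = / 8 * (zeta_nat 2 / 2).
Proof.
  apply (integral_coef_eq 1 pp); [|apply int_pp].
  intro u. unfold integrand_coef; simpl. rewrite G_coef_0. field.
Qed.

Lemma integral_coef_2 : integral_coef 2 = / 16 * zeta_nat 3.
Proof.
  apply (integral_coef_eq 2 (fun u => pp u * qq u)); [|apply int_pp_qq].
  intro u. unfold integrand_coef; simpl. rewrite G_coef_0, G_coef_1, qq_eq. field.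
Qed.

Lemma integral_coef_3 : integral_coef 3 = / 96 * (- (9 / 2) * zeta_nat 4).
Proof.
  eapply integral_coef_eq; [|apply int_coef_3].
  intro u. unfold integrand_coef; simpl. rewrite G_coef_0, G_coef_1, G_coef_2. field.
Qed.

Lemma integral_coef_4 : integral_coef 4 = / 192 * (- 12 * (zeta_nat 2 * zeta_nat 3)).
Proof.
  eapply integral_coef_eq; [|apply int_coef_4].
  intro u. unfold integrand_coef; simpl. rewrite G_coef_0, G_coef_1, G_coef_2, G_coef_3. field.
Qed.

(** The bound on the integrand is uniform in e, so integrating it, with V the integral of (1 +
    u)^(K+1) exp (- u), yields the constant 2 C V. *)
Lemma I_seq_expansion_S (K : nat) :
  exists C, forall n : nat, (1 <= n)%nat ->
    Rabs (I_seq n - sum_f_R0 (fun i => I_coef i / INR n ^ i) (S K)) <= C / INR n ^ S (S K).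
Proof.
  destruct (integrand_expansion K) as [C HC].
  destruct (int_inf_poly_exp (S K)) as [V HV].
  exists (2 * C * V). intros [|n] Hn; [lia|]. clear Hn.
  pose proof (inv_INR_S_le_1 n) as He. pose proof (int_I_seq n) as HI.
  cbv zeta in HI. set (e := / INR (S n)) in *.
  assert (Pe : forall i, / INR (S n) ^ i = e ^ i) by (intro; unfold e; now rewrite pow_inv).
  rewrite decomp_sum by lia. simpl pred.
  assert (H : int_inf
    (fun u => 2 * e * (G_deriv 0 (e * u) * (exp (e * pp u) - 1)
                       - sum_f_R0 (fun i => e ^ i * integrand_coef i u) K))
    (I_seq (S n) - 3 / 4 - 2 * e * sum_f_R0 (fun i => e ^ i * integral_coef i) K)).
  { apply int_inf_ext with (fun u => 2 * e * (G_deriv 0 (e * u) * (exp (e * pp u) - 1))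
      - 2 * e * sum_f_R0 (fun i => e ^ i * integrand_coef i u) K); [intro; ring|].
    apply int_inf_minus; auto. apply int_inf_scal.
    apply (int_inf_sum (fun i u => e ^ i * integrand_coef i u)).
    intros i _. apply int_inf_scal, int_integrand_coef. }
  apply (int_inf_scal (2 * e ^ S (S K) * C)) in HV.
  replace (I_seq (S n) - _) with
    (I_seq (S n) - 3 / 4 - 2 * e * sum_f_R0 (fun i => e ^ i * integral_coef i) K).
  - unfold Rdiv. rewrite Pe. replace (2 * C * V * e ^ S (S K)) with (2 * e ^ S (S K) * C * V) by ring.
    refine (int_inf_abs_le _ _ _ _ _ H HV).
    intros u Hu. rewrite Rabs_mult, (Rabs_pos_eq (2 * e)) by lra.
    rewrite <- (tech_pow_Rmult e (S K)).
    replace (2 * (e * e ^ S K) * C * ((1 + u) ^ S K * exp (- u))) with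
      (2 * e * (e ^ S K * (C * ((1 + u) ^ S K * exp (- u))))) by ring.
    apply Rmult_le_compat_l; [lra|]. now apply HC.
  - rewrite scal_sum. simpl (I_coef 0 / _). rewrite Rdiv_1_r.
    rewrite (sum_eq (fun i => I_coef (S i) / INR (S n) ^ S i)
      (fun i => e ^ i * integral_coef i * (2 * e))); [ring|].
    intros i _. unfold Rdiv. rewrite Pe. simpl. ring.
Qed.

Lemma I_seq_expansion : asymptotic_expansion I_seq I_coef.
Proof.
  intro K. destruct K as [|K].
  (* For K = 0 the expansion to order 1 serves: its additional term is 0, and C / n^2 <= max(0, C) /
     n, the maximum covering a negative C. *)
  - destruct (I_seq_expansion_S 0) as [C HC]. exists (Rmax 0 C), 0%nat. intros n Hn _.
    specialize (HC n Hn). simpl in HC |- *. rewrite integral_coef_0 in HC.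
    destruct n as [|n]; [lia|].
    pose proof (inv_INR_S_le_1 n) as He. pose proof (INR_S_pos n).
    set (N := INR (S n)) in *.
    replace (3 / 4 / 1 + 2 * 0 / (N * 1)) with (3 / 4 / 1) in HC by (field; lra).
    eapply Rle_trans; [exact HC|].
    replace (C / (N * (N * 1))) with (/ N * (C * / N)) by (field; lra).
    unfold Rdiv. rewrite Rmult_1_r.
    pose proof (Rmax_l 0 C). pose proof (Rmax_r 0 C).
    apply Rle_trans with (/ N * (Rmax 0 C * / N)).
    + apply Rmult_le_compat_l; [lra|]. apply Rmult_le_compat_r; lra.
    + rewrite <- (Rmult_1_l (Rmax 0 C * / N)) at 2. apply Rmult_le_compat_r; [|lra].
      apply Rmult_le_pos; lra.
  - destruct (I_seq_expansion_S K) as [C HC]. exists C, 0%nat. intros n Hn _. now apply HC.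
Qed.

Theorem theorem5p1 :
  exists a : nat -> R,
    asymptotic_expansion I_seq a /\
    a 0%nat = 3 / 4 /\
    a 1%nat = 0 /\
    a 2%nat = PI ^ 2 / 48 /\
    a 3%nat = zeta 3 / 8 /\
    a 4%nat = - (PI ^ 4 / 960) /\
    a 5%nat = - (zeta 3 * PI ^ 2 / 48).
Proof.
  assert (Z : zeta 3 = zeta_nat 3).
  { rewrite <- zeta_INR. f_equal. simpl. ring. }
  exists I_coef. unfold I_coef.
  rewrite integral_coef_0, integral_coef_1, integral_coef_2, integral_coef_3, integral_coef_4, Z, zeta_nat_2, zeta_nat_4.
  repeat split; try field. apply I_seq_expansion.
Qed.
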